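(* Let $(A^+,\Delta)$ be a monoidal Garside structure such that $A^+$ has a $\nu$-structure, and let $A$ be the associated Garside group. Let $\mathrm{Conj}(A)$ be the groupoid whose objects are the standard parabolic subgroups $A_X$ of $A$, whose set of morphisms from $A_X$ to $A_Y$ is $\{g\in A\mid g^{-1}A_Xg=A_Y\}$, and whose composition is the product in $A$. Let $\mathcal{P}(A)$ be the totally disconnected groupoid whose objects are the standard parabolic subgroups of $A$ and whose vertex group at $A_X$ is $A_X$. Then there exists a standard parabolic subgroupoid $\mathcal{R}^\nu(A)$ of the ribbon groupoid $\mathcal{R}(A)$ such that $\mathrm{Conj}(A)$ is equal to the semi-direct product of groupoids $\mathcal{P}(A)\rtimes\mathcal{R}^\nu(A)$.
   Context: All categories are small and composition is written from left to right: for $v:x\to y$ and $w:y\to z$ the composite is $vw:x\to z$. For a category $\mathcal{C}$, $\mathcal{C}_{x\to y}$ is the set of morphisms from $x$ to $y$, and $\mathcal{C}_{x\to\cdot}$, $\mathcal{C}_{\cdot\to x}$ are the sets of morphisms with source $x$, resp. target $x$. A natural transformation $\Delta$ from a functor $F$ to a functor $G$ satisfies $\Delta(x)G(v)=F(v)\Delta(y)$ for $v:x\to y$. A morphism $v$ left-divides $w$ if $w=vu$ for some $u$, right-divides $w$ if $w=uv$; $w$ is a factor of $w'$ if $w'=w_1ww_2$. $\mathcal{C}$ is noetherian if every infinite sequence $(w_i)$ of morphisms with $w_{i+1}$ a factor of $w_i$ for all $i$ is eventually constant. $\mathcal{C}$ is cancellative if composition on the left and on the right by any given morphism is injective. An atom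 is a non-identity morphism that is not a product of two non-identity morphisms. A categorical Garside structure is a pair $(\mathcal{C},\Delta)$ such that: $\mathcal{C}$ is a noetherian cancellative category equipped with an automorphism $\Phi$, and $\Delta$ is a natural transformation from $\mathrm{Id}_{\mathcal{C}}$ to $\Phi$; for every object $x$, $\mathcal{C}_{x\to\cdot}$ and $\mathcal{C}_{\cdot\to x}$ are lattices for left-divisibility and right-divisibility respectively; for every atom $v\in\mathcal{C}_{x\to y}$ there is $\overline v\in\mathcal{C}_{y\to\Phi(x)}$ with $v\overline v=\Delta(x)$ and $\overline v\,\Phi(v)=\Delta(y)$. Its groupoid of formal inverses $\mathcal{G}(\mathcal{C})$ is a Garside groupoid, in which $\mathcal{C}$ embeds. If $\mathcal{C}$ has one object, $(\mathcal{C},\Delta)$ is a monoidal Garside structure, $\mathcal{C}$ is a Garside monoid and $\mathcal{G}(\mathcal{C})$ (its group of fractions) is a Garside group. Given a categorical Garside structure $(\mathcal{C},\Delta)$, a subcategory $\mathcal{P}$ of $\mathcal{C}$ is a parabolic subcategory if for every object $x$ of $\mathcal{P}$ the sets $\mathcal{P}_{x\to\cdot}$, $\mathcal{P}_{\cdot\to x}$ are sublattices of $\mathcal{C}_{x\to\cdot}$, $\mathcal{C}_{\cdot\to x}$, and there are an automorphism $\phi$ of $\mathcal{P}$ and morphisms $\delta(x)\in\mathcal{C}_{x\to\phi(x)}$ ($x$ an object of $\mathcal{P}$) with $\delta(x)\phi(v)=v\delta(y)$ for all $v\in\mathcal{P}_{x\to y}$, such that for every object $x$ of $\mathcal{P}$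 the set of left-divisors of $\delta(x)$ in $\mathcal{C}$ equals the set of left-divisors of $\Delta(x)$ lying in $\mathcal{P}_{x\to\cdot}$ and equals $\{\Delta(x)\wedge p: p\in\mathcal{P}_{x\to\cdot}\}$. Then $\mathcal{G}(\mathcal{P})$ embeds in $\mathcal{G}(\mathcal{C})$; the subgroupoids of $\mathcal{G}(\mathcal{C})$ of this form are its standard parabolic subgroupoids. For a Garside monoid $A^+$ the parabolic subcategories are called parabolic submonoids; $A_X^+$ denotes a parabolic submonoid with atom set $X$ (a subset of the atom set $S$ of $A^+$), and $A_X$ the subgroup of $A$ it generates, called a standard parabolic subgroup; $A_X\cap A^+=A_X^+$. The positive ribbon category $\mathcal{R}^+(A^+)$ has as objects the parabolic submonoids of $A^+$; morphisms from $A_X^+$ to $A_Y^+$ are the $g\in A^+$ with $g^{-1}A_X^+g=A_Y^+$; composition is the product. The ribbon groupoid $\mathcal{R}(A)$ has as objects the $A_X$; morphisms from $A_X$ to $A_Y$ are the $g\in A$ with $g^{-1}A_X^+g=A_Y^+$. When $A^+$ has a $\nu$-structure (defined next), $\mathcal{R}^+(A^+)$ with the natural transformation equal to $\Delta$ at every object is a categorical Garside structure with associated Garside groupoid $\mathcal{R}(A)$; standard parabolic subgroupoids of $\mathcal{R}(A)$ refer to this structure. Let $\vee$ (resp. $\tilde\vee$) be the lcm in $A^+$ for left- (resp. right-) divisibility. $A^+$ has a $\nu$-function if for each parabolic submonoid $A_X^+$ there is a map $\nu_X:S\to\mathcal{R}^+(A^+)_{A_X^+\to\cdot}$ such that: (1)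 each $\nu_X(s)$ is an atom of $\mathcal{R}^+(A^+)$; (2) for $s\in S$ and $g\in\mathcal{R}^+(A^+)_{A_X^+\to\cdot}$, if $s$ left-divides $g$ then $\nu_X(s)$ left-divides $g$; (3) for all $s,t\in S$, $\nu_X(s)\vee\nu_X(t)$ lies in $\mathcal{R}^+(A^+)_{A_X^+\to\cdot}$. $A^+$ has a $\tilde\nu$-function if for each $A_X^+$ there is a map $\tilde\nu_X:S\to\mathcal{R}^+(A^+)_{\cdot\to A_X^+}$ such that: (1) each $\tilde\nu_X(s)$ is an atom of $\mathcal{R}^+(A^+)$; (2) for $s\in S$ and $g\in\mathcal{R}^+(A^+)_{\cdot\to A_X^+}$, if $s$ right-divides $g$ then $\tilde\nu_X(s)$ right-divides $g$; (3) for all $s,t\in S$, $\tilde\nu_X(s)\tilde\vee\tilde\nu_X(t)$ lies in $\mathcal{R}^+(A^+)_{\cdot\to A_X^+}$. $A^+$ has a $\nu$-structure if it has both. Semi-direct product: let $\mathcal{D},\mathcal{D}'$ be subcategories of a category $\mathcal{C}$ with $\mathcal{D}$ totally disconnected (the union of its vertex monoids $\mathcal{D}_{x\to x}$). One writes $\mathcal{C}=\mathcal{D}\rtimes\mathcal{D}'$ if every morphism $g$ of $\mathcal{C}$ decomposes uniquely as $g=g_1g_2$ with $g_1$ a morphism of $\mathcal{D}$ and $g_2$ a morphism of $\mathcal{D}'$, and $\mathcal{D}_{x\to x}\,g=g\,\mathcal{D}_{y\to y}$ for every $g\in\mathcal{D}'_{x\to y}$. *)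

(* Defs.v *)
From HB Require Import structures.
From mathcomp Require Import all_boot.
From mathcomp Require Import boolp classical_sets.

Set Implicit Arguments.
Unset Strict Implicit.
Unset Printing Implicit Defensive.

Import Algebra.

Local Open Scope classical_set_scope.

Declare Scope cat_scope.
Delimit Scope cat_scope with cat.
Local Open Scope cat_scope.

Record category := Category {
  ob :> Type;
  hom : ob -> ob -> Type;
  idm : forall x, hom x x;
  comp : forall x y z, hom x y -> hom y z -> hom x z;
  comp1m : forall x y (f : hom x y), comp (idm x) f = f;
  compm1 : forall x y (f : hom x y), comp f (idm y) = f;
  compA : forall x y z t (f : hom x y) (g : hom y z) (h : hom z t),
    comp f (comp g h) = comp (comp f g) h
}.

Arguments hom {c} x y.
Arguments idm {c} x.
Arguments comp {c x y z} f g.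

(* Composition is written from left to right. *)
Notation "f >> g" := (comp f g) (at level 40, left associativity) : cat_scope.

Record functor (C D : category) := Functor {
  fob :> C -> D;
  fmap : forall x y : C, hom x y -> hom (fob x) (fob y);
  fmap_id : forall x, fmap (idm x) = idm (fob x);
  fmap_comp : forall x y z (f : hom x y) (g : hom y z),
    fmap (f >> g) = fmap f >> fmap g
}.

Arguments fmap {C D} f {x y} v : rename.

(* An isomorphism of categories: bijective on objects and on morphisms. *)
Definition is_automorphism (C : category) (F : functor C C) : Prop :=
  bijective F /\ forall x y : C, bijective (@fmap C C F x y).

Record subcategory (C : category) := Subcategory {
  sub_ob : set C;
  sub_hom : forall x y : C, set (hom x y);
  sub_homP : forall x y (v : hom x y), sub_hom v -> sub_ob x /\ sub_ob y;
  sub_id : forall x, sub_ob x -> sub_hom (idm x);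
  sub_comp : forall x y z (v : hom x y) (w : hom y z),
    sub_hom v -> sub_hom w -> sub_hom (v >> w)
}.

Arguments sub_ob {C} s x.
Arguments sub_hom {C} s {x y} v.

Definition cat_of_sub (C : category) (P : subcategory C) : category.
Proof.
refine (@Category {x : C | sub_ob P x}
  (fun x y => {v : hom (sval x) (sval y) | sub_hom P v})
  (fun x => exist _ _ (sub_id (svalP x)))
  (fun x y z v w => exist _ _ (sub_comp (svalP v) (svalP w))) _ _ _).
- by move=> x y [f Pf]; apply: eq_exist; exact: comp1m.
- by move=> x y [f Pf]; apply: eq_exist; exact: compm1.
- by move=> x y z t [f Pf] [g Pg] [h Ph]; apply: eq_exist; exact: compA.
Defined.

Record groupoid := Groupoid {
  gcat :> category;
  invm : forall x y : gcat, hom x y -> hom y x;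
  compmV : forall (x y : gcat) (f : hom x y), f >> invm f = idm x;
  compVm : forall (x y : gcat) (f : hom x y), invm f >> f = idm y
}.

Arguments invm {g x y} f : rename.

Record subgroupoid (G : groupoid) := Subgroupoid {
  subgpd_cat :> subcategory G;
  sub_inv : forall (x y : G) (v : hom x y),
    sub_hom subgpd_cat v -> sub_hom subgpd_cat (invm v)
}.

Arguments Subgroupoid {G} subgpd_cat sub_inv : rename.

Section Generated.
Variables (C : category) (G : groupoid) (J : functor C G) (P : subcategory C).

Inductive gen_hom : forall a b : G, hom a b -> Prop :=
| gen_fmap (x y : C) (v : hom x y) of sub_hom P v : gen_hom (fmap J v)
| gen_comp (a b c : G) (f : hom a b) (g : hom b c) of gen_hom f & gen_hom g :
    gen_hom (f >> g)
| gen_inv (a b : G) (f : hom a b) of gen_hom f : gen_hom (invm f).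

Lemma gen_homP (a b : G) (v : hom a b) :
  gen_hom v -> (J @` sub_ob P) a /\ (J @` sub_ob P) b.
Proof.
by elim=> [x y u /sub_homP[Px Py]|? ? ? ? ? _ [? _] _ [_ ?]|? ? ? _ []].
Qed.

Lemma gen_id (a : G) : (J @` sub_ob P) a -> gen_hom (idm a).
Proof. by move=> [x Px <-]; rewrite -fmap_id; apply/gen_fmap/sub_id. Qed.

Definition generated_subgroupoid : subgroupoid G :=
  @Subgroupoid G (Subcategory gen_homP gen_id gen_comp) gen_inv.

End Generated.

Section Divisibility.
Variable C : category.

Definition arrow := {x : C & {y : C & @hom C x y}}.
Definition mk_arrow (x y : C) (v : hom x y) : arrow := existT _ x (existT _ y v).

Definition factor (f g : arrow) : Prop :=
  exists w1 : hom (tag g) (tag f),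
  exists w2 : hom (tag (tagged f)) (tag (tagged g)),
    tagged (tagged g) = w1 >> tagged (tagged f) >> w2.

Definition noetherian : Prop :=
  forall w : nat -> arrow, (forall i, factor (w i.+1) (w i)) ->
  exists N, forall i, N <= i -> w i = w N.

Definition cancellative : Prop :=
  (forall (x y z : C) (u : hom x y), injective (fun v : hom y z => u >> v)) /\
  (forall (x y z : C) (u : hom y z), injective (fun v : hom x y => v >> u)).

Definition is_identity (x y : C) (v : hom x y) : Prop :=
  exists z, mk_arrow v = mk_arrow (idm z).

Definition atom (x y : C) (v : hom x y) : Prop :=
  ~ is_identity v /\
  ~ exists (z : C) (u : hom x z) (w : hom z y),
      [/\ ~ is_identity u, ~ is_identity w & v = u >> w].

(* [under x] is C_{x -> .} and [over x] is C_{. -> x}. *)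
Definition under (x : C) := {y : C & @hom C x y}.
Definition over (y : C) := {x : C & @hom C x y}.
Definition mk_under (x y : C) (v : hom x y) : under x := existT _ y v.
Definition mk_over (x y : C) (v : hom x y) : over y := existT _ x v.

Definition ldiv (x : C) (v w : under x) : Prop :=
  exists u : hom (tag v) (tag w), tagged w = tagged v >> u.
Definition rdiv (y : C) (v w : over y) : Prop :=
  exists u : hom (tag w) (tag v), tagged w = u >> tagged v.

End Divisibility.

Section Lattices.
Variables (T : Type) (le : T -> T -> Prop).

Definition is_meet (a b m : T) : Prop :=
  [/\ le m a, le m b & forall c, le c a -> le c b -> le c m].
Definition is_join (a b m : T) : Prop :=
  [/\ le a m, le b m & forall c, le a c -> le b c -> le m c].

Definition is_lattice : Prop :=
  [/\ forall a, le a a,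
      forall b a c, le a b -> le b c -> le a c,
      forall a b, le a b -> le b a -> a = b
    & forall a b, (exists m, is_meet a b m) /\ (exists m, is_join a b m)].

(* [S] is closed under the meets and joins of the ambient lattice. *)
Definition is_sublattice (S : set T) : Prop :=
  forall a b, S a -> S b ->
    (exists2 m, is_meet a b m & S m) /\ (exists2 m, is_join a b m & S m).

End Lattices.

Record garside_data (C : category) := GarsideData {
  Phi : functor C C;
  Delta : forall x : C, hom x (Phi x)
}.

Arguments Phi {C} g.
Arguments Delta {C} g x.

Definition garside_structure (C : category) (G : garside_data C) : Prop :=
  [/\ noetherian C /\ cancellative C,
      is_automorphism (Phi G),
      forall (x y : C) (v : hom x y),
        Delta G x >> fmap (Phi G) v = v >> Delta G y,
      forall x : C, is_lattice (@ldiv C x) /\ is_lattice (@rdiv C x)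
    & forall (x y : C) (v : hom x y), atom v ->
        exists vbar : hom y (Phi G x),
          v >> vbar = Delta G x /\ vbar >> fmap (Phi G) v = Delta G y].

(* P_{x -> .} and P_{. -> x} for a subcategory P. *)
Definition sub_under (C : category) (P : subcategory C) (x : C) :
  set (under x) := [set v : under x | sub_hom P (tagged v)].
Definition sub_over (C : category) (P : subcategory C) (x : C) :
  set (over x) := [set v : over x | sub_hom P (tagged v)].

Definition parabolic (C : category) (G : garside_data C) (P : subcategory C) :
    Prop :=
  (forall x : C, sub_ob P x ->
     is_sublattice (@ldiv C x) (sub_under P (x := x)) /\
     is_sublattice (@rdiv C x) (sub_over P (x := x))) /\
  exists (phi : functor (cat_of_sub P) (cat_of_sub P))
         (delta : forall x : cat_of_sub P, @hom C (sval x) (sval (phi x))),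
  [/\ is_automorphism phi,
      forall (x y : cat_of_sub P) (v : hom x y),
        delta x >> sval (fmap phi v) = sval v >> delta y
    & forall x : cat_of_sub P,
        let D := mk_under (Delta G (sval x)) in
        [set v | ldiv v (mk_under (delta x))] =
          [set v | ldiv v D] `&` sub_under P (x := sval x) /\
        [set v | ldiv v (mk_under (delta x))] =
          [set m | exists2 p, sub_under P p & is_meet (@ldiv C _) D p m]].

(* [J : C -> G] is the canonical functor from a categorical Garside structure
   to its groupoid of formal inverses; the image of G(P) in G(C) is then the
   subgroupoid generated by P. *)
Definition standard_parabolic_subgroupoid (C : category) (GC : garside_data C)
    (G : groupoid) (J : functor C G) (Q : subgroupoid G) : Prop :=
  exists P : subcategory C, parabolic GC P /\ Q = generated_subgroupoid J P.

Local Open Scope group_scope.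

Definition monoid_cat (M : monoidType) : category :=
  @Category unit (fun _ _ => M) (fun _ => 1) (fun _ _ _ => mul)
    (fun _ _ => @mul1g M) (fun _ _ => @mulg1 M) (fun _ _ _ _ => @mulgA M).

Record is_submonoid (M : monoidType) (X : set M) : Prop := IsSubmonoid {
  submonoid1 : X 1;
  submonoidM : forall m n, X m -> X n -> X (m * n)
}.

Definition submonoid_cat (M : monoidType) (X : set M) (HX : is_submonoid X) :
    subcategory (monoid_cat M) :=
  @Subcategory (monoid_cat M) setT (fun _ _ => X) (fun _ _ _ _ => conj I I)
    (fun _ _ => submonoid1 HX) (fun _ _ _ m n => @submonoidM _ _ HX m n).

Definition parabolic_submonoid (M : monoidType)
    (G : garside_data (monoid_cat M)) (X : set M) : Prop :=
  exists HX : is_submonoid X, parabolic G (submonoid_cat HX).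

(* Universal property of the group of formal inverses of M. Multiplicative maps
   into a group preserve 1. *)
Definition is_group_of_formal_inverses (M : monoidType) (A : groupType)
    (iota : {multiplicative M -> A}) : Prop :=
  forall (H : groupType) (f : {multiplicative M -> H}),
    (exists g : {multiplicative A -> H}, g \o iota =1 f) /\
    (forall g g' : {multiplicative A -> H},
        g \o iota =1 f -> g' \o iota =1 f -> g =1 g').

Section OrderIso.
Variables (T : Type) (le : T -> T -> Prop) (f g : T -> T).
Hypotheses (fK : cancel f g) (gK : cancel g f).
Hypothesis lef : forall a b, le (f a) (f b) <-> le a b.

Lemma is_meet_iso a b m : is_meet le (f a) (f b) (f m) <-> is_meet le a b m.
Proof.
split=> -[/lef ma /lef mb mc]; split=> // c.
  by move=> /lef ca /lef cb; apply/lef/mc.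
by rewrite -(gK c) => /lef ca /lef cb; apply/lef/mc.
Qed.

Lemma is_join_iso a b m : is_join le (f a) (f b) (f m) <-> is_join le a b m.
Proof.
split=> -[/lef ma /lef mb mc]; split=> // c.
  by move=> /lef ca /lef cb; apply/lef/mc.
by rewrite -(gK c) => /lef ca /lef cb; apply/lef/mc.
Qed.

Lemma is_sublattice_iso (S S' : set T) : (forall a, S' (f a) <-> S a) ->
  is_sublattice le S -> is_sublattice le S'.
Proof.
move=> SS' HS a b; rewrite -(gK a) -(gK b) => /SS' Sa /SS' Sb.
have [[m Hm Sm] [j Hj Sj]] := HS _ _ Sa Sb.
by split; [exists (f m) | exists (f j)];
   rewrite ?is_meet_iso ?is_join_iso //; apply/SS'.
Qed.

End OrderIso.

Section ParabolicImage.
Variables (M : monoidType) (G : garside_data (monoid_cat M)).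
Hypothesis gG : garside_structure G.

Let F (m : M) : M := @fmap _ _ (Phi G) tt tt m.
Let D : M := Delta G tt.

Lemma Phi1 : F 1 = 1. Proof. exact: (@fmap_id _ _ (Phi G) tt). Qed.
Lemma PhiM m n : F (m * n) = F m * F n.
Proof. exact: (@fmap_comp _ _ (Phi G) tt tt tt). Qed.

Lemma PhiE (x y : monoid_cat M) (m : M) : @fmap _ _ (Phi G) x y m = F m.
Proof. by case: x y => -[]. Qed.

Lemma DeltaE (x : monoid_cat M) : Delta G x = D.
Proof. by case: x. Qed.

Lemma DeltaC (m : M) : D * F m = m * D.
Proof. by case: gG => _ _ /(_ tt tt m). Qed.

Lemma PhiDelta : F D = D.
Proof.
by case: gG => -[_ [/(_ tt tt tt D)cI _]] _ _ _ _; apply: cI => /=; exact: DeltaC.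
Qed.

Lemma image_submonoid (X : set M) : is_submonoid X -> is_submonoid (F @` X).
Proof.
move=> HX; split; first by exists 1; [exact: submonoid1 | exact: Phi1].
move=> _ _ [m Xm <-] [n Xn <-]; exists (m * n); last exact: PhiM.
exact: submonoidM.
Qed.

Lemma parabolic_image (X : set M) :
  parabolic_submonoid G X -> parabolic_submonoid G (F @` X).
Proof.
case: (gG) => _ [_ /(_ tt tt)[E FK EK]] _ _ _.
have {}FK : cancel F E by []. have {}EK : cancel E F by [].
case=> HX [latX [phi [delta [[phibij phiB] phiC phiP]]]].
have HX' := image_submonoid HX; exists HX'.
have FI : injective F := can_inj FK.
have XF m : (F @` X) (F m) <-> X m.
  by split=> [[n Xn /FI <-]|Xm]; [|exists m].
have E1 : E 1 = 1 by apply: FI; rewrite EK Phi1.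
have EM m n : E (m * n) = E m * E n by apply: FI; rewrite PhiM !EK.
pose fu (a : @under (monoid_cat M) tt) := @mk_under (monoid_cat M) tt (tag a) (F (tagged a)).
pose gu (a : @under (monoid_cat M) tt) := @mk_under (monoid_cat M) tt (tag a) (E (tagged a)).
pose fo (a : @over (monoid_cat M) tt) := @mk_over (monoid_cat M) (tag a) tt (F (tagged a)).
pose go (a : @over (monoid_cat M) tt) := @mk_over (monoid_cat M) (tag a) tt (E (tagged a)).
have fuK : cancel fu gu by move=> [x m]; rewrite /fu /gu /= FK.
have guK : cancel gu fu by move=> [x m]; rewrite /fu /gu /= EK.
have foK : cancel fo go by move=> [x m]; rewrite /fo /go /= FK.
have goK : cancel go fo by move=> [x m]; rewrite /fo /go /= EK.
have lefu a b : ldiv (fu a) (fu b) <-> ldiv a b.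
  split=> -[u]; rewrite /= => Hu.
    exists (E u : @hom (monoid_cat M) _ _); apply: FI.
    by rewrite [RHS]PhiM EK.
  exists (F u : @hom (monoid_cat M) _ _).
  exact: (etrans (congr1 F Hu) (PhiM _ _)).
have lefo a b : rdiv (fo a) (fo b) <-> rdiv a b.
  split=> -[u]; rewrite /= => Hu.
    exists (E u : @hom (monoid_cat M) _ _); apply: FI.
    by rewrite [RHS]PhiM EK.
  exists (F u : @hom (monoid_cat M) _ _).
  exact: (etrans (congr1 F Hu) (PhiM _ _)).
have subF : forall a, sub_under (submonoid_cat HX') (fu a) <->
    sub_under (submonoid_cat HX) a by move=> [x m]; exact: XF.
split.
  move=> [] _; have [|Lu Lo] := latX tt; first by [].
  split; first exact: (is_sublattice_iso guK lefu subF).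
  by apply: (is_sublattice_iso goK lefo) Lo => -[x m]; exact: XF.
have @dn (x y : cat_of_sub (submonoid_cat HX')) (v : hom x y) :
    @hom (cat_of_sub (submonoid_cat HX)) x y.
  by exists (E (sval v)); case: (svalP v) => m Xm <-; rewrite FK.
have @up (x y : cat_of_sub (submonoid_cat HX)) (v : hom x y) :
    @hom (cat_of_sub (submonoid_cat HX')) x y.
  by exists (F (sval v)); exists (sval v) => //; exact: (svalP v).
have @phi' : functor (cat_of_sub (submonoid_cat HX')) (cat_of_sub (submonoid_cat HX')).
  refine (@Functor (cat_of_sub (submonoid_cat HX')) (cat_of_sub (submonoid_cat HX'))
    phi (fun x y v => up _ _ (fmap phi (dn x y v))) _ _).
    move=> x; apply: eq_exist => /=.
    have -> : dn x x (idm x) = idm (x : cat_of_sub (submonoid_cat HX)).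
      by apply: eq_exist => /=; exact: E1.
    by rewrite fmap_id /=; exact: Phi1.
  move=> x y z v w; apply: eq_exist => /=.
  have -> : dn x z (v >> w)%cat = (dn x y v >> dn y z w)%cat.
    by apply: eq_exist => /=; exact: EM.
  by rewrite fmap_comp /=; exact: PhiM.
pose delta' (x : cat_of_sub (submonoid_cat HX')) : @hom (monoid_cat M) (sval x)
  (sval (phi' x)) := F (delta x).
have dnK x y : cancel (dn x y) (up x y).
  by move=> [v Xv]; apply: eq_exist => /=; rewrite EK.
have upK x y : cancel (up x y) (dn x y).
  by move=> [v Xv]; apply: eq_exist => /=; rewrite FK.
exists phi', delta'; split.
- split; first exact: phibij.
  move=> x y; have [q qK Kq] := phiB x y.
  exists (fun v => up _ _ (q (dn (phi x) (phi y) v))) => v /=.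
    by rewrite (upK (phi x) (phi y)) qK dnK.
  by rewrite upK Kq dnK.
- move=> x y v; have := congr1 F (phiC x y (dn x y v)).
  by rewrite !PhiM /= EK.
- move=> [[] xT]; have [] := phiP (exist _ tt xT).
  rewrite /= => P1 P2.
  have fuD : fu (mk_under (Delta G tt)) = mk_under (Delta G tt).
    exact: (congr1 (@mk_under (monoid_cat M) tt (Phi G tt)) PhiDelta).
  have fud : fu (mk_under (delta (exist _ tt xT))) =
    mk_under (delta' (exist _ tt xT)) by [].
  split; apply/predeqP => v; rewrite -(guK v); set w := gu v.
    move/predeqP/(_ w): P1 => /= P1; rewrite -fud -fuD.
    split=> [/lefu/P1[Hw Xw]|[/lefu Hw Xw]].
      by split; [exact/lefu | exact: (subF w).2 Xw].
    by apply/lefu/P1; split=> //; exact: (subF w).1 Xw.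
  move/predeqP/(_ w): P2 => /= P2; rewrite -fud -fuD.
  split=> [/lefu/P2[p Xp Hp]|[p]].
    by exists (fu p); [exact: (subF p).2 Xp | exact/(is_meet_iso guK lefu)].
  rewrite -(guK p) => Xp /(is_meet_iso guK lefu) Hp.
  by apply/lefu/P2; exists (gu p) => //; exact: (subF _).1 Xp.
Qed.

End ParabolicImage.

Definition conj_set (A : groupType) (X : set A) (g : A) : set A :=
  [set x ^ g | x in X].

Lemma conj_set1 (A : groupType) (X : set A) : conj_set X 1 = X.
Proof.
by rewrite -[RHS]image_id; apply: eq_imagel => x _; exact: conjg1.
Qed.

Lemma conj_setM (A : groupType) (X : set A) (g h : A) :
  conj_set X (g * h) = conj_set (conj_set X g) h.
Proof.
by rewrite /conj_set image_comp; apply: eq_imagel => x _; exact: conjgM.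
Qed.

Lemma conj_setV (A : groupType) (X Y : set A) (g : A) :
  conj_set X g = Y -> conj_set Y g^-1 = X.
Proof. by move=> <-; rewrite -conj_setM mulgV conj_set1. Qed.

Definition is_subgroup (A : groupType) (H : set A) : Prop :=
  [/\ H 1, forall g h, H g -> H h -> H (g * h) & forall g, H g -> H g^-1].

Definition subgroup_generated (A : groupType) (X : set A) : set A :=
  smallest (@is_subgroup A) X.

Section Ribbons.
Variables (M : monoidType) (G : garside_data (monoid_cat M)).
Variables (A : groupType) (iota : {multiplicative M -> A}).

(* The parabolic submonoids A_X^+. They also index the standard parabolic
   subgroups: A_X^+ determines A_X, and is recovered from it as the
   intersection of A_X with A^+. *)
Definition parab : Type := {X : set M | parabolic_submonoid G X}.

Definition pos (X : parab) : set A := iota @` sval X.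
Definition std (X : parab) : set A := subgroup_generated (pos X).

Lemma iota1 : iota 1 = 1.
Proof. by apply: (mulgI (iota 1)); rewrite -gmulfM !mulg1. Qed.

Definition is_ribbon (X Y : parab) (g : A) : Prop := conj_set (pos X) g = pos Y.

Lemma is_ribbon1 X : is_ribbon X X 1.
Proof. exact: conj_set1. Qed.

Lemma is_ribbonM X Y Z g h :
  is_ribbon X Y g -> is_ribbon Y Z h -> is_ribbon X Z (g * h).
Proof. by rewrite /is_ribbon conj_setM => ->. Qed.

Lemma is_ribbonV X Y g : is_ribbon X Y g -> is_ribbon Y X g^-1.
Proof. exact: conj_setV. Qed.

(* The positive ribbon category R^+(A^+). *)
Definition ribbon_category : category.
Proof.
refine (@Category parab (fun X Y => {g : M | is_ribbon X Y (iota g)})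
  (fun X => exist _ 1 _)
  (fun X Y Z g h => exist _ (sval g * sval h) _) _ _ _).
- by move=> X Y [g Hg]; apply: eq_exist; exact: mul1g.
- by move=> X Y [g Hg]; apply: eq_exist; exact: mulg1.
- by move=> X Y Z T [g Hg] [h Hh] [k Hk]; apply: eq_exist; exact: mulgA.
Unshelve.
- by rewrite iota1; exact: is_ribbon1.
- by rewrite gmulfM; exact: is_ribbonM (svalP g) (svalP h).
Defined.

Definition ribbon_groupoid_cat : category.
Proof.
refine (@Category parab (fun X Y => {g : A | is_ribbon X Y g})
  (fun X => exist _ 1 (is_ribbon1 X))
  (fun X Y Z g h =>
     exist _ (sval g * sval h) (is_ribbonM (svalP g) (svalP h))) _ _ _).
- by move=> X Y [g Hg]; apply: eq_exist; exact: mul1g.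
- by move=> X Y [g Hg]; apply: eq_exist; exact: mulg1.
- by move=> X Y Z T [g Hg] [h Hh] [k Hk]; apply: eq_exist; exact: mulgA.
Defined.

Definition ribbon_groupoid : groupoid.
Proof.
refine (@Groupoid ribbon_groupoid_cat
  (fun X Y g => exist _ (sval g)^-1 (is_ribbonV (svalP g))) _ _).
- by move=> X Y [g Hg]; apply: eq_exist; exact: mulgV.
- by move=> X Y [g Hg]; apply: eq_exist; exact: mulVg.
Defined.

Definition ribbon_functor : functor ribbon_category ribbon_groupoid.
Proof.
refine (@Functor ribbon_category ribbon_groupoid id
  (fun X Y g => exist _ (iota (sval g)) (svalP g)) _ _).
- by move=> X; apply: eq_exist; exact: iota1.
- by move=> X Y Z g h; apply: eq_exist; exact: gmulfM.
Defined.

Definition is_std_conj (X Y : parab) (g : A) : Prop :=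
  conj_set (std X) g = std Y.

Lemma is_std_conj1 X : is_std_conj X X 1.
Proof. exact: conj_set1. Qed.

Lemma is_std_conjM X Y Z g h :
  is_std_conj X Y g -> is_std_conj Y Z h -> is_std_conj X Z (g * h).
Proof. by rewrite /is_std_conj conj_setM => ->. Qed.

Lemma is_std_conjV X Y g : is_std_conj X Y g -> is_std_conj Y X g^-1.
Proof. exact: conj_setV. Qed.

Definition conj_groupoid_cat : category.
Proof.
refine (@Category parab (fun X Y => {g : A | is_std_conj X Y g})
  (fun X => exist _ 1 (is_std_conj1 X))
  (fun X Y Z g h =>
     exist _ (sval g * sval h) (is_std_conjM (svalP g) (svalP h))) _ _ _).
- by move=> X Y [g Hg]; apply: eq_exist; exact: mul1g.
- by move=> X Y [g Hg]; apply: eq_exist; exact: mulg1.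
- by move=> X Y Z T [g Hg] [h Hh] [k Hk]; apply: eq_exist; exact: mulgA.
Defined.

Definition conj_groupoid : groupoid.
Proof.
refine (@Groupoid conj_groupoid_cat
  (fun X Y g => exist _ (sval g)^-1 (is_std_conjV (svalP g))) _ _).
- by move=> X Y [g Hg]; apply: eq_exist; exact: mulgV.
- by move=> X Y [g Hg]; apply: eq_exist; exact: mulVg.
Defined.

Lemma subgroup_std X : is_subgroup (std X).
Proof.
split=> [H [[]]//|g h Xg Xh H [HH XH]|g Xg H [HH XH]]; case: (HH) => _ HM HV.
  by apply: HM; [apply: Xg | apply: Xh].
by apply: HV; apply: Xg.
Qed.

Lemma std_conj_sub X Y g :
  conj_set (pos X) g `<=` pos Y -> conj_set (std X) g `<=` std Y.
Proof.
move=> XY _ [x Xx <-]; apply: (Xx [set h | std Y (h ^ g)]).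
have [Y1 YM YV] := subgroup_std Y.
split; last by move=> h Xh H [_]; apply; apply: XY; exists h.
split=> [|h k /= Yh Yk|h /= Yh].
- by rewrite /= conj1g.
- by rewrite conjMg; exact: YM.
- by rewrite conjVg; exact: YV.
Qed.

Lemma ribbon_std_conj X Y g : is_ribbon X Y g -> is_std_conj X Y g.
Proof.
move=> XY; rewrite /is_std_conj eqEsubset; split.
  by apply: std_conj_sub; rewrite XY.
rewrite -{1}[std Y]conj_set1 -(mulVg g) conj_setM.
apply: image_subset; apply: std_conj_sub.
by have /seteqP[] := is_ribbonV XY.
Qed.

(* R(A) is a subgroupoid of Conj(A) with the same objects; this is a
   subgroupoid of R(A) regarded as a subgroupoid of Conj(A). *)
Definition ribbon_in_conj_hom (Q : subgroupoid ribbon_groupoid)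
    (X Y : conj_groupoid) : set (hom X Y) :=
  [set v | exists2 r : @hom ribbon_groupoid X Y,
             sub_hom Q r & sval r = sval v].

Definition ribbon_in_conj_cat (Q : subgroupoid ribbon_groupoid) :
  subcategory conj_groupoid.
Proof.
refine (@Subcategory conj_groupoid (sub_ob Q) (ribbon_in_conj_hom Q) _ _ _).
- by move=> X Y v [r /sub_homP].
- by move=> X QX; exists (@idm ribbon_groupoid X) => //; exact: sub_id.
- move=> X Y Z v w [r Qr rv] [s Qs sw]; exists (r >> s)%cat => /=.
    exact: sub_comp.
  by rewrite rv sw.
Defined.

Definition ribbon_in_conj (Q : subgroupoid ribbon_groupoid) :
  subgroupoid conj_groupoid.
Proof.
refine (@Subgroupoid conj_groupoid (ribbon_in_conj_cat Q) _).
move=> X Y v [r Qr rv]; exists (@invm ribbon_groupoid _ _ r).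
  exact: (@sub_inv ribbon_groupoid Q).
by rewrite /= rv.
Defined.

(* P(A), as a subgroupoid of Conj(A). *)
Definition parabolic_groupoid_cat : subcategory conj_groupoid.
Proof.
refine (@Subcategory conj_groupoid setT
  (fun X Y => [set v | X = Y /\ std X (sval v)]) (fun _ _ _ _ => conj I I) _ _).
- by move=> X _; split=> //=; case: (subgroup_std X).
- move=> X Y Z v w [XY Xv] [YZ Yw]; split; first exact: etrans YZ.
  by subst Y Z; case: (subgroup_std X) => _ XM _; exact: XM.
Defined.

Definition parabolic_groupoid : subgroupoid conj_groupoid.
Proof.
refine (@Subgroupoid conj_groupoid parabolic_groupoid_cat _).
move=> X Y v [XY Xv]; split; first exact: esym.
by subst Y; case: (subgroup_std X) => _ _; exact.
Defined.

End Ribbons.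

(* Conjugation by Delta: A_X^+ is sent to Phi(A_X^+), and a ribbon g to Phi(g). *)
Section RibbonGarside.
Variables (M : monoidType) (G : garside_data (monoid_cat M)).
Hypothesis gG : garside_structure G.
Variables (A : groupType) (iota : {multiplicative M -> A}).

Let F (m : M) : M := @fmap _ _ (Phi G) tt tt m.
Let D : M := Delta G tt.

Definition Phi_parab (X : parab G) : parab G :=
  exist _ (F @` sval X) (parabolic_image gG (svalP X)).

Lemma conj_Delta (m : M) : iota m ^ iota D = iota (F m).
Proof. by rewrite conjgE -gmulfM -(DeltaC gG) gmulfM mulKg. Qed.

Lemma pos_Phi (X : parab G) :
  pos iota (Phi_parab X) = conj_set (pos iota X) (iota D).
Proof.
rewrite /pos /conj_set /= !image_comp; apply: eq_imagel => m _ /=.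
by rewrite conj_Delta.
Qed.

Lemma Delta_ribbon (X : parab G) : is_ribbon iota X (Phi_parab X) (iota D).
Proof. by rewrite /is_ribbon pos_Phi. Qed.

Lemma Phi_ribbon (X Y : parab G) (g : M) : is_ribbon iota X Y (iota g) ->
  is_ribbon iota (Phi_parab X) (Phi_parab Y) (iota (F g)).
Proof.
rewrite /is_ribbon !pos_Phi => <-; rewrite -!conj_setM -!gmulfM.
by rewrite (DeltaC gG).
Qed.

Definition Phi_ribbon_functor :
  functor (ribbon_category G iota) (ribbon_category G iota).
Proof.
refine (@Functor (ribbon_category G iota) (ribbon_category G iota) Phi_parab
  (fun X Y g => exist _ (F (sval g)) (Phi_ribbon (svalP g))) _ _).
- by move=> X; apply: eq_exist; exact: Phi1.
- by move=> X Y Z g h; apply: eq_exist; exact: PhiM.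
Defined.

Definition ribbon_garside : garside_data (ribbon_category G iota) :=
  @GarsideData (ribbon_category G iota) Phi_ribbon_functor
    (fun X => exist _ D (Delta_ribbon X)).

End RibbonGarside.

Section Nu.
Variables (M : monoidType) (G : garside_data (monoid_cat M)).
Variables (A : groupType) (iota : {multiplicative M -> A}).

Let C := monoid_cat M.
Let R := ribbon_category G iota.

Definition mon_under (m : M) : @under C tt := @mk_under C tt tt m.
Definition mon_over (m : M) : @over C tt := @mk_over C tt tt m.
Definition atoms : Type := {s : M | @atom C tt tt s}.

Definition is_nu (X : R) (nu : atoms -> under X) : Prop :=
  [/\ forall s, atom (tagged (nu s)),
      forall s (g : under X),
        ldiv (mon_under (sval s)) (mon_under (sval (tagged g))) -> ldiv (nu s) g
    & forall s t, exists2 j : M,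
        is_join (@ldiv C tt) (mon_under (sval (tagged (nu s))))
          (mon_under (sval (tagged (nu t)))) (mon_under j)
        & exists Y : R, is_ribbon iota X Y (iota j)].

Definition is_nu_tilde (X : R) (nu : atoms -> over X) : Prop :=
  [/\ forall s, atom (tagged (nu s)),
      forall s (g : over X),
        rdiv (mon_over (sval s)) (mon_over (sval (tagged g))) -> rdiv (nu s) g
    & forall s t, exists2 j : M,
        is_join (@rdiv C tt) (mon_over (sval (tagged (nu s))))
          (mon_over (sval (tagged (nu t)))) (mon_over j)
        & exists Y : R, is_ribbon iota Y X (iota j)].

Definition has_nu_function : Prop := forall X : R, exists nu, is_nu (X := X) nu.
Definition has_nu_tilde_function : Prop :=
  forall X : R, exists nu, is_nu_tilde (X := X) nu.
Definition has_nu_structure : Prop := has_nu_function /\ has_nu_tilde_function.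

End Nu.

Definition totally_disconnected (C : category) (D : subcategory C) : Prop :=
  forall (x y : C) (v : hom x y), sub_hom D v -> x = y.

Definition semidirect_product (C : category) (D D' : subcategory C) : Prop :=
  [/\ totally_disconnected D,
      forall (x z : C) (g : hom x z),
        exists! d : {y : C & (@hom C x y * @hom C y z)%type},
          [/\ sub_hom D (tagged d).1, sub_hom D' (tagged d).2
            & g = ((tagged d).1 >> (tagged d).2)%cat]
    & forall (x y : C) (g : hom x y), sub_hom D' g ->
        [set (d >> g)%cat | d in [set d : hom x x | sub_hom D d]] =
        [set (g >> d)%cat | d in [set d : hom y y | sub_hom D d]]].

(* Main.v *)
(* Write M for A^+, and say that g in M is X-reduced if no nontrivial element of
   A_X^+ left-divides it. If g in M conjugates A_X to A_Y, split off of g its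
   A_X^+-part on the left, then its A_Y^+-part on the right: the remaining factor
   conjugates A_X to A_Y and is reduced on both sides, and clearing denominators
   shows that it conjugates A_X^+ to A_Y^+. Hence g = a b with a in A_X^+ and b an
   X-reduced ribbon, uniquely, and g |-> b is a functorial retraction of the
   ribbons onto the reduced ones. So the reduced ribbons form a parabolic
   subcategory: the nu-structure makes the left and right divisibility orders on
   ribbons lattices, the retraction preserves divisibility, and delta(X) is the
   reduced part of Delta. Multiplying by a power of Delta extends the
   decomposition from M to A; it is unique because a fraction p q^-1 of X-reduced
   elements lies in A_X only if p = q. *)
From HB Require Import structures.
Require Import Defs.
From mathcomp Require Import all_boot generic_quotient.
From mathcomp Require Import boolp classical_sets.

Set Implicit Arguments.
Unset Strict Implicit.
Unset Printing Implicit Defensive.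

Import Algebra.

Local Open Scope classical_set_scope.
Local Open Scope group_scope.

Lemma sval_inj (T : Type) (P : T -> Prop) : injective (@sval T P).
Proof. by move=> [x Px] [y Py] /= xy; exact: eq_exist. Qed.

Definition lle (M : monoidType) (a b : M) : Prop := exists u, b = a * u.
Definition rle (M : monoidType) (a b : M) : Prop := exists u, b = u * a.

Definition proper_factor (M : monoidType) (a b : M) : Prop :=
  a <> b /\ exists u v, b = u * a * v.

Section Divisibility.
Variable M : monoidType.
Implicit Types a b c : M.

Lemma lle_refl a : lle a a. Proof. by exists 1; rewrite mulg1. Qed.
Lemma lle1 a : lle 1 a. Proof. by exists a; rewrite mul1g. Qed.
Lemma lle_mulr a b : lle a (a * b). Proof. by exists b. Qed.
Lemma lle_trans b a c : lle a b -> lle b c -> lle a c.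
Proof. by move=> [u ->] [v ->]; exists (u * v); rewrite mulgA. Qed.
Lemma lle_mul2l c a b : lle a b -> lle (c * a) (c * b).
Proof. by move=> [u ->]; exists u; rewrite mulgA. Qed.

End Divisibility.

Section GarsideMonoid.
Variables (M : monoidType) (G : garside_data (monoid_cat M)).
Hypothesis gG : garside_structure G.
Implicit Types a b c : M.

Definition gphi (a : M) : M := @fmap _ _ (Phi G) tt tt a.
Definition gdelta : M := Delta G tt.

Lemma lcancel a b c : a * b = a * c -> b = c.
Proof. by case: gG => -[_ [H _]] _ _ _ _; exact: (H tt tt tt a b c). Qed.

Lemma rcancel a b c : b * a = c * a -> b = c.
Proof. by case: gG => -[_ [_ H]] _ _ _ _; exact: (H tt tt tt a b c). Qed.

Lemma lle_mul2lE c a b : lle (c * a) (c * b) -> lle a b.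
Proof. by move=> [u]; rewrite -mulgA => /lcancel ->; exists u. Qed.

Lemma lle_anti a b : lle a b -> lle b a -> a = b.
Proof.
case: gG => _ _ _ /(_ tt)[[_ _ anti _] _] _ ab ba.
have e : mon_under a = mon_under b by exact: anti.
exact: (congr1 (fun m : @under (monoid_cat M) tt => tagged m : M) e).
Qed.

Lemma mul_eq1 a b : a * b = 1 -> a = 1 /\ b = 1.
Proof.
move=> ab1; have a1 : a = 1.
  by apply: lle_anti; [exists b | exact: lle1].
by split=> //; move: ab1; rewrite a1 mul1g.
Qed.

Lemma lle_eq1 a : lle a 1 -> a = 1.
Proof. by move=> [u /esym/mul_eq1[]]. Qed.

Lemma ljoin a b : exists j, [/\ lle a j, lle b j &
  forall c, lle a c -> lle b c -> lle j c].
Proof.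
case: gG => _ _ _ /(_ tt)[[_ _ _ jn] _] _.
have [_ [[[] j] [aj bj jc]]] := jn (mon_under a) (mon_under b).
by exists j; split=> // c; exact: (jc (mon_under c)).
Qed.

Lemma lmeet a b : exists m, [/\ lle m a, lle m b &
  forall c, lle c a -> lle c b -> lle c m].
Proof.
case: gG => _ _ _ /(_ tt)[[_ _ _ jn] _] _.
have [[[[] j] [aj bj jc]] _] := jn (mon_under a) (mon_under b).
by exists j; split=> // c; exact: (jc (mon_under c)).
Qed.

Lemma rjoin a b : exists j, [/\ rle a j, rle b j &
  forall c, rle a c -> rle b c -> rle j c].
Proof.
case: gG => _ _ _ /(_ tt)[_ [_ _ _ jn]] _.
have [_ [[[] j] [aj bj jc]]] := jn (mon_over a) (mon_over b).
by exists j; split=> // c; exact: (jc (mon_over c)).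
Qed.

Lemma proper_factor_wf : well_founded (@proper_factor M).
Proof.
move=> a; apply: contrapT => nacc.
have step (b : {b : M | ~ Acc (@proper_factor M) b}) :
    {c : {b : M | ~ Acc (@proper_factor M) b} | proper_factor (sval c) (sval b)}.
  apply: cid; apply: contrapT => H; apply: (svalP b); constructor => c cb.
  by apply: contrapT => nc; apply: H; exists (exist _ c nc).
pose w := fix w n := if n is n'.+1 then sval (step (w n')) else exist _ a nacc.
have wP n : proper_factor (sval (w n.+1)) (sval (w n)) := svalP (step (w n)).
case: gG => -[noeth _] _ _ _ _.
have [|N NP] := noeth (fun i => @mk_arrow (monoid_cat M) tt tt (sval (w i))).
  by move=> i; have [_ [u [v ?]]] := wP i; exists u, v.
have [neq _] := wP N; apply: neq.
exact: (congr1 (fun f : arrow (monoid_cat M) => tagged (tagged f) : M)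
  (NP N.+1 (leqnSn N))).
Qed.

Lemma proper_factor_mull a b : a <> 1 -> proper_factor b (a * b).
Proof.
move=> a1; split; last by exists a, 1; rewrite mulg1.
by rewrite -{1}[b]mul1g => /rcancel/esym.
Qed.

Lemma proper_factor_mulr a b : b <> 1 -> proper_factor a (a * b).
Proof.
move=> b1; split; last by exists 1, b; rewrite mul1g.
by rewrite -{1}[a]mulg1 => /lcancel/esym.
Qed.

Definition matom (s : M) : Prop := @atom (monoid_cat M) tt tt s.

Lemma mon_identity a : @is_identity (monoid_cat M) tt tt a <-> a = 1.
Proof.
split=> [[z /(congr1 (fun f : arrow (monoid_cat M) => tagged (tagged f) : M))]|->] //.
by exists tt.
Qed.

Lemma matom_neq1 s : matom s -> s <> 1.
Proof. by move=> [s1 _] /mon_identity. Qed.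

Lemma matom_delta s : matom s -> exists t, s * t = gdelta /\ t * gphi s = gdelta.
Proof. by case: gG => _ _ _ _ H /H. Qed.

Lemma not_matom s : s <> 1 -> ~ matom s ->
  exists u v, [/\ u <> 1, v <> 1 & s = u * v].
Proof.
move=> s1 ns; apply: contrapT => H; apply: ns; split; first by move/mon_identity.
move=> [[] [u [v [u1 v1 suv]]]]; apply: H.
by exists u, v; split=> // e; [apply: u1|apply: v1]; exact/mon_identity.
Qed.

Lemma lle_atom a : a <> 1 -> exists s b, matom s /\ a = s * b.
Proof.
elim/(well_founded_ind proper_factor_wf): a => a IH a1.
have [aa|/(not_matom a1)[u [v [u1 v1 auv]]]] := pselect (matom a).
  by exists a, 1; rewrite mulg1.
have [|s [b [sa ub]]] := IH u _ u1; first by rewrite auv; exact: proper_factor_mulr.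
by exists s, (b * v); rewrite mulgA -ub.
Qed.

Lemma rle_atom a : a <> 1 -> exists s b, matom s /\ a = b * s.
Proof.
elim/(well_founded_ind proper_factor_wf): a => a IH a1.
have [aa|/(not_matom a1)[u [v [u1 v1 auv]]]] := pselect (matom a).
  by exists a, 1; rewrite mul1g.
have [|s [b [sa vb]]] := IH v _ v1; first by rewrite auv; exact: proper_factor_mull.
by exists s, (u * b); rewrite -mulgA -vb.
Qed.

(* The intrinsic description of the parabolic submonoids used throughout: all
   conditions are invariant under automorphisms of M fixing Delta. *)
Record elem_parabolic (X : set M) (d : M) : Prop := ElemParabolic {
  ep_submonoid : is_submonoid X;
  ep_factor : forall a b, X (a * b) -> X a /\ X b;
  ep_mem : X d;
  ep_ldelta : lle d gdelta;
  ep_max : forall a, X a -> lle a gdelta -> lle a d;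
  ep_right : forall a, X a -> exists2 b, X b & a * d = d * b;
  ep_left : forall b, X b -> exists2 a, X a & a * d = d * b
}.

Lemma elem_parabolic_full : elem_parabolic setT gdelta.
Proof.
split=> //.
- exact: lle_refl.
- by move=> a _; exists (gphi a) => //; rewrite -(DeltaC gG).
- move=> b _; case: (gG) => _ [_ /(_ tt tt)[E FK EK]] _ _ _.
  exists (E b) => //; rewrite -(DeltaC gG); congr (_ * _); exact: EK.
Qed.

Section Elem.
Variables (X : set M) (d : M).
Hypothesis hX : elem_parabolic X d.

Lemma ep_rightX k a : X a -> exists2 b, X b & a * d ^+ k = d ^+ k * b.
Proof.
elim: k a => [|k IH] a Xa; first by exists a; rewrite ?expg0 ?mulg1 ?mul1g.
have [b Xb ab] := ep_right hX Xa; have [c Xc bc] := IH b Xb.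
by exists c => //; rewrite expgS mulgA ab -!mulgA bc.
Qed.

Lemma ep_leftX k b : X b -> exists2 a, X a & a * d ^+ k = d ^+ k * b.
Proof.
elim: k b => [|k IH] b Xb; first by exists b; rewrite ?expg0 ?mulg1 ?mul1g.
have [a Xa ab] := ep_left hX Xb; have [c Xc bc] := IH a Xa.
by exists c => //; rewrite expgSr mulgA bc -!mulgA ab.
Qed.

Lemma ep_expg k : X (d ^+ k).
Proof.
have [X1 XM] := ep_submonoid hX; elim: k => [|k IH]; first by rewrite expg0.
by rewrite expgS; apply: XM => //; exact: ep_mem hX.
Qed.

Lemma ep_lle_expg a : X a -> exists k b, X b /\ a * b = d ^+ k.
Proof.
have [X1 XM] := ep_submonoid hX.
elim/(well_founded_ind proper_factor_wf): a => a IH Xa.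
have [->|a1] := EM (a = 1); first by exists 0, 1; rewrite mulg1 expg0.
have [s [b [sa ab]]] := lle_atom a1.
have [Xs Xb] : X s /\ X b by apply: (ep_factor hX); rewrite -ab.
have [k [c [Xc bc]]] : exists k c, X c /\ b * c = d ^+ k.
  by apply: IH => //; rewrite ab; apply: proper_factor_mull; exact: matom_neq1.
have [t dst] : lle s d.
  by apply: (ep_max hX) => //; have [t [<- _]] := matom_delta sa; exact: lle_mulr.
have [_ Xt] : X s /\ X t by apply: (ep_factor hX); rewrite -dst; exact: ep_mem hX.
have [t' Xt' tt'] := ep_rightX k Xt.
exists k.+1, (c * t'); split; first exact: XM.
by rewrite ab !mulgA -(mulgA s b c) bc -mulgA -tt' mulgA -dst expgS.
Qed.

Lemma ep_rle_expg a : X a -> exists k b, X b /\ b * a = d ^+ k.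
Proof.
move=> Xa; have [k [b [Xb ab]]] := ep_lle_expg Xa.
have [a' Xa' ka] := ep_leftX k Xa; have [b' Xb' kb] := ep_leftX k Xb.
exists k, b'; split=> //.
have ab' : a' * b' = d ^+ k.
  by apply: (@rcancel (d ^+ k)); rewrite -mulgA kb mulgA ka -mulgA ab.
by apply: (@lcancel a'); rewrite mulgA ab' ka.
Qed.

End Elem.

Lemma parabolic_elem (X : set M) :
  parabolic_submonoid G X -> exists d, elem_parabolic X d.
Proof.
case=> HX [_ [phi [delta [[_ phiB] phiC phiP]]]].
have [X1 XM] := HX.
pose o : cat_of_sub (submonoid_cat HX) := exist _ tt I.
pose d : M := delta o; exists d.
have dE (v : M) (Xv : X v) : d * sval (fmap phi (exist _ v Xv : @hom _ o o)) = v * d.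
  exact: (phiC o o (exist _ v Xv)).
have [] := phiP o; rewrite /= => P1 P2.
have dP v : lle v d <-> lle v gdelta /\ X v.
  by have /predeqP/(_ (mon_under v)) := P1.
have Xd : X d by have [] := (dP d).1 (lle_refl d).
have dle : lle d gdelta by have [] := (dP d).1 (lle_refl d).
have dR a : X a -> exists2 b, X b & a * d = d * b.
  move=> Xa; exists (sval (fmap phi (exist _ a Xa : @hom _ o o))); last by rewrite -dE.
  exact: (svalP (fmap phi (exist _ a Xa : @hom _ o o))).
have dL b : X b -> exists2 a, X a & a * d = d * b.
  move=> Xb; have [psi _ psiK] := phiB o o.
  exists (sval (psi (exist _ b Xb : @hom _ (phi o) (phi o)))).
    exact: (svalP (psi (exist _ b Xb : @hom _ (phi o) (phi o)))).
  move: (psiK (exist _ b Xb)); case: (psi _) => a Xa pa.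
  by rewrite /= -(dE a Xa) pa.
have dhead s p : X p -> lle s p -> lle s gdelta -> lle s d.
  move=> Xp sp sD; have [m [mD mp mc]] := lmeet gdelta p.
  apply: lle_trans (mc _ sD sp) _.
  have /predeqP/(_ (mon_under m))[_] := P2; apply.
  exists (mon_under p) => //; split=> // -[[] c] cD cp; exact: mc.
have cofactor s t : d = s * t -> X t.
  move=> dst; have [_ Xs] : lle s gdelta /\ X s.
    by apply/dP; rewrite dst; exact: lle_mulr.
  have [b Xb sb] := dR s Xs.
  have [] : lle t gdelta /\ X t; last by [].
  by apply/dP; exists b; apply: (@lcancel s); rewrite sb {1}dst mulgA.
(* Removing from the left an atom of an element of X need not obviously stay in
   X, but it does so after multiplication by a power of d. *)
have stable k p : X (p * d ^+ k) -> X p.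
  elim/(well_founded_ind proper_factor_wf): p k => p IH k Xp.
  have [->|p1] := EM (p = 1); first exact: X1.
  have [s [q [sa pq]]] := lle_atom p1.
  have sd : lle s d.
    apply: dhead Xp _ _; first by rewrite pq -mulgA; exact: lle_mulr.
    by have [t [<- _]] := matom_delta sa; exact: lle_mulr.
  have Xs : X s by have [] := (dP s).1 sd.
  have [t dst] := sd; have Xt := cofactor _ _ dst.
  rewrite pq; apply: (XM) => //; apply: (IH q _ k.+1).
    by rewrite pq; apply: proper_factor_mull; exact: matom_neq1.
  have [b Xb pb] := dR _ Xp.
  have -> : q * d ^+ k.+1 = t * b.
    by apply: (@lcancel s); rewrite [RHS]mulgA -dst -pb pq expgSr !mulgA.
  exact: XM.
have tail s q : matom s -> X (s * q) -> X s /\ X q.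
  move=> sa Xsq.
  have sd : lle s d.
    apply: dhead Xsq (lle_mulr _ _) _.
    by have [t [<- _]] := matom_delta sa; exact: lle_mulr.
  have Xs : X s by have [] := (dP s).1 sd.
  have [t dst] := sd; have Xt := cofactor _ _ dst; split=> //.
  apply: (stable 1%N); rewrite expg1; have [b Xb pb] := dR _ Xsq.
  have -> : q * d = t * b by apply: (@lcancel s); rewrite [RHS]mulgA -dst -pb mulgA.
  exact: XM.
split=> //.
- move=> a; elim/(well_founded_ind proper_factor_wf): a => a IH b Xab.
  have [a1|a1] := EM (a = 1); first by move: Xab; rewrite a1 mul1g.
  have [s [a' [sa aa']]] := lle_atom a1.
  have [Xs Xa'b] : X s /\ X (a' * b) by apply: tail; rewrite // mulgA -aa'.
  have [|Xa' Xb] := IH a' _ _ Xa'b.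
    by rewrite aa'; apply: proper_factor_mull; exact: matom_neq1.
  by split=> //; rewrite aa'; exact: XM.
- by move=> a Xa aD; apply/dP.
Qed.

Lemma ep_ljoin X d a b : elem_parabolic X d -> X a -> X b -> exists j,
  [/\ X j, lle a j, lle b j & forall c, lle a c -> lle b c -> lle j c].
Proof.
move=> hX Xa Xb; have [j [aj bj jc]] := ljoin a b; exists j; split=> //.
have [k [a' [Xa' ak]]] := ep_lle_expg hX Xa.
have [l [b' [Xb' bl]]] := ep_lle_expg hX Xb.
have [c cE] : lle j (d ^+ (k + l)).
  apply: jc; first by rewrite expgnDr -ak -mulgA; exact: lle_mulr.
  by rewrite addnC expgnDr -bl -mulgA; exact: lle_mulr.
have [] : X j /\ X c; last by [].
by apply: (ep_factor hX); rewrite -cE; exact: ep_expg hX _.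
Qed.

Lemma ep_rjoin X d a b : elem_parabolic X d -> X a -> X b -> exists j,
  [/\ X j, rle a j, rle b j & forall c, rle a c -> rle b c -> rle j c].
Proof.
move=> hX Xa Xb; have [j [aj bj jc]] := rjoin a b; exists j; split=> //.
have [k [a' [Xa' ak]]] := ep_rle_expg hX Xa.
have [l [b' [Xb' bl]]] := ep_rle_expg hX Xb.
have [c cE] : rle j (d ^+ (k + l)).
  apply: jc; first by rewrite addnC expgnDr -ak mulgA; eexists.
  by rewrite expgnDr -bl mulgA; eexists.
have [] : X c /\ X j; last by [].
by apply: (ep_factor hX); rewrite -cE; exact: ep_expg hX _.
Qed.

Lemma elem_parabolicP (X : set M) d :
  elem_parabolic X d -> parabolic_submonoid G X.
Proof.
move=> hX; have HX := ep_submonoid hX; exists HX; have [X1 XM] := HX.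
have meetX (a b m : M) : X a -> lle m a -> X m.
  by move=> Xa [u au]; have [] : X m /\ X u by apply: (ep_factor hX); rewrite -au.
split.
  move=> [] _; split=> -[[] a] [[] b] Xa Xb.
    split; last first.
      have [j [Xj aj bj jc]] := ep_ljoin hX Xa Xb.
      by exists (mon_under j) => //; split=> // -[[] c]; exact: jc.
    have [m [ma mb mc]] := lmeet a b.
    by exists (mon_under m); [split=> // -[[] c]; exact: mc | exact: meetX Xa ma].
  split; last first.
    have [j [Xj aj bj jc]] := ep_rjoin hX Xa Xb.
    by exists (mon_over j) => //; split=> // -[[] c]; exact: jc.
  case: gG => _ _ _ /(_ tt)[_ [_ _ _ jn]] _.
  have [[[[] m] Hm] _] := jn (mon_over a) (mon_over b).
  exists (mon_over m) => //; have [[u au] _ _] := Hm.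
  have [] : X u /\ X m by apply: (ep_factor hX); rewrite -(au : a = u * m).
  by [].
have /choice[f fP] : forall a : M, exists b, X a -> X b /\ a * d = d * b.
  move=> a; have [Xa|nXa] := EM (X a); last by exists a.
  by have [b Xb ab] := ep_right hX Xa; exists b.
have f1 : f 1 = 1.
  by apply: (@lcancel d); rewrite -(fP 1 X1).2 mul1g mulg1.
have fM a b : X a -> X b -> f (a * b) = f a * f b.
  move=> Xa Xb; apply: (@lcancel d).
  by rewrite -(fP _ (XM _ _ Xa Xb)).2 mulgA -(fP a Xa).2 -!mulgA -(fP b Xb).2.
pose C := cat_of_sub (submonoid_cat HX).
pose phim (x y : C) (v : @hom C x y) : @hom C x y :=
  exist _ (f (sval v) : @hom (monoid_cat M) _ _) (fP (sval v) (svalP v)).1.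
have phi1 (x : C) : phim _ _ (idm x) = idm x by apply: eq_exist; exact: f1.
have phiM (x y z : C) (v : @hom C x y) (w : @hom C y z) :
    phim _ _ (Defs.comp v w) = Defs.comp (phim _ _ v) (phim _ _ w).
  by apply: eq_exist; exact: fM (svalP v) (svalP w).
exists (@Functor C C id phim phi1 phiM), (fun _ => d); split.
- split; first by exists id.
  move=> x y; have /choice[g gP] : forall w : @hom C x y, exists v : @hom C x y,
      sval v * d = d * (sval w : M).
    move=> [w Xw]; have [v Xv vw] := ep_left hX Xw.
    by exists (exist _ (v : @hom (monoid_cat M) _ _) Xv).
  exists g => v; apply: sval_inj.
    by apply: (@rcancel d); rewrite gP /= -(fP _ (svalP v)).2.
  by apply: (@lcancel d); rewrite /= -(fP _ (svalP (g v))).2 gP.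
- by move=> x y v; rewrite /= -(fP _ (svalP v)).2.
- move=> [[] xT] D.
  have sub v : lle v d -> X v /\ lle v gdelta.
    move=> vd; split; first exact: meetX (ep_mem hX) vd.
    exact: lle_trans vd (ep_ldelta hX).
  split; apply/predeqP => -[[] v]; split.
  + by move=> /sub[].
  + by move=> [vD Xv]; exact: (ep_max hX).
  + by move=> /sub[Xv vD]; exists (mon_under v) => //; split=> //; exact: lle_refl.
  + move=> [[[] p] Xp [mD mp _]]; apply: (ep_max hX) => //; exact: meetX Xp mp.
Qed.

Lemma gphi_bij : exists2 E : M -> M, cancel gphi E & cancel E gphi.
Proof. by case: gG => _ [_ /(_ tt tt)[E FK EK]] _ _ _; exists E. Qed.

Lemma gphiM a b : gphi (a * b) = gphi a * gphi b. Proof. exact: PhiM. Qed.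
Lemma gphi1 : gphi 1 = 1. Proof. exact: Phi1. Qed.
Lemma gdeltaC a : gdelta * gphi a = a * gdelta. Proof. exact: DeltaC. Qed.
Lemma gphi_delta : gphi gdelta = gdelta. Proof. exact: PhiDelta. Qed.

Lemma gphi_inj : injective gphi.
Proof. by have [E FK _] := gphi_bij; exact: can_inj FK. Qed.

Lemma gphi_lle a b : lle (gphi a) (gphi b) <-> lle a b.
Proof.
split=> -[u]; last by move=> ->; exists (gphi u); rewrite gphiM.
have [E FK EK] := gphi_bij.
by rewrite -(EK u) -gphiM => /gphi_inj ->; exists (E u).
Qed.

Lemma parabolic_gphi_preimage (X : set M) :
  parabolic_submonoid G X -> parabolic_submonoid G (gphi @^-1` X).
Proof.
move=> /parabolic_elem[d hX]; have [E FK EK] := gphi_bij.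
apply: (@elem_parabolicP _ (E d)).
have [[X1 XM] fac Xd dD dmax dR dL] := hX; split=> //.
- by split=> [|a b]; rewrite /preimage /= ?gphi1 ?gphiM //; exact: XM.
- by move=> a b; rewrite /preimage /= gphiM; exact: fac.
- by rewrite /preimage /= EK.
- by apply/gphi_lle; rewrite EK gphi_delta.
- move=> a Xa aD; apply/gphi_lle; rewrite EK; apply: dmax => //.
  by rewrite -gphi_delta; exact/gphi_lle.
- move=> a /dR[b Xb ab]; exists (E b); rewrite /preimage /= ?EK //.
  by apply: gphi_inj; rewrite !gphiM !EK.
- move=> b /dL[a Xa ab]; exists (E a); rewrite /preimage /= ?EK //.
  by apply: gphi_inj; rewrite !gphiM !EK.
Qed.

End GarsideMonoid.

(** * The group of fractions *)

Section Fractions.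
Variables (M : monoidType) (G : garside_data (monoid_cat M)).
Hypothesis gG : garside_structure G.
Local Notation D := (gdelta G).
Local Notation phi j := (iter j (gphi G)).

Lemma gdeltaXC j (a : M) : D ^+ j * phi j a = a * D ^+ j.
Proof.
elim: j a => [|j IH] a; first by rewrite expg0 mul1g mulg1.
by rewrite iterSr expgS -mulgA IH mulgA gdeltaC // -mulgA.
Qed.

Lemma iter_gphiM j : {morph phi j : a b / a * b}.
Proof. by elim: j => [|j IH] a b //; rewrite !iterS IH; exact: gphiM. Qed.

Lemma iter_gphi_deltaX j k : phi j (D ^+ k) = D ^+ k.
Proof.
by apply: (lcancel gG (a := D ^+ j)); rewrite gdeltaXC -!expgnDr addnC.
Qed.

Lemma delta_lmultiple (a : M) : exists k b, a * b = D ^+ k.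
Proof.
have [k [b [_ ab]]] := ep_lle_expg gG (elem_parabolic_full gG) (I : setT a).
by exists k, b.
Qed.

Lemma delta_rmultiple (a : M) : exists k b, b * a = D ^+ k.
Proof.
have [k [b [_ ab]]] := ep_rle_expg gG (elem_parabolic_full gG) (I : setT a).
by exists k, b.
Qed.

(* The pair (a, j) stands for the fraction a Delta^-j. *)
Definition frac_eq (p q : M * nat) : bool := p.1 * D ^+ q.2 == q.1 * D ^+ p.2.

Lemma frac_eq_equiv : equiv_class_of frac_eq.
Proof.
split=> [p|p q|q p r]; rewrite /frac_eq; [exact: eqxx|exact: eq_sym|].
move=> /eqP pq /eqP qr; apply/eqP.
apply: (rcancel gG (a := D ^+ q.2)).
rewrite -mulgA -expgnDr addnC expgnDr mulgA pq -mulgA -expgnDr addnC expgnDr.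
by rewrite mulgA qr -!mulgA -!expgnDr addnC.
Qed.

Canonical frac_equiv : equiv_rel (M * nat) := EquivRelPack frac_eq_equiv.

Definition fracs : Type := {eq_quot frac_equiv}%qT.
HB.instance Definition _ : EqQuotient _ frac_equiv fracs := EqQuotient.on fracs.
HB.instance Definition _ := Choice.on fracs.

Definition frac (p : M * nat) : fracs := (\pi_fracs p)%qT.

Lemma fracP p q : frac p = frac q <-> p.1 * D ^+ q.2 = q.1 * D ^+ p.2.
Proof.
split=> [/(@eqmodP _ frac_equiv _ _)/eqP //|pq].
by apply/(@eqmodP _ frac_equiv _ _)/eqP.
Qed.

Lemma frac_repr (x : fracs) : exists p, x = frac p.
Proof. by exists (repr x); rewrite /frac reprK. Qed.

Definition fmul (p q : M * nat) : M * nat := (p.1 * phi p.2 q.1, p.2 + q.2).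

Lemma fmul_frac p p' q q' : frac p = frac p' -> frac q = frac q' ->
  frac (fmul p q) = frac (fmul p' q').
Proof.
case: p p' q q' => [m j] [m' j'] [n k] [n' k'] /fracP /= mm /fracP /= nn.
apply/fracP => /=.
have mn : m * phi j n * D ^+ j' = m' * phi j' n * D ^+ j.
  by rewrite -!mulgA -!gdeltaXC !mulgA mm -!iterD addnC.
have {nn}nn : phi j' n * D ^+ k' = phi j' n' * D ^+ k.
  by rewrite -{1}(iter_gphi_deltaX j' k') -iter_gphiM nn iter_gphiM iter_gphi_deltaX.
rewrite expgnDr mulgA mn -mulgA -expgnDr addnC expgnDr.
by rewrite -(mulgA m') (mulgA (phi j' n)) nn -!mulgA -expgnDr addnC.
Qed.

Lemma fmulA p q r : fmul p (fmul q r) = fmul (fmul p q) r.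
Proof. by rewrite /fmul /= iter_gphiM iterD mulgA addnA. Qed.

Lemma iter_gphi1 j : phi j 1 = 1.
Proof. by apply: (lcancel gG (a := D ^+ j)); rewrite gdeltaXC mul1g mulg1. Qed.

Lemma fmul1p p : fmul (1, 0) p = p.
Proof. by case: p => m j; rewrite /fmul /= mul1g. Qed.

Lemma fmulp1 p : fmul p (1, 0) = p.
Proof. by case: p => m j; rewrite /fmul /= iter_gphi1 mulg1 addn0. Qed.

Lemma fmul_inv p : exists q,
  frac (fmul p q) = frac (1, 0) /\ frac (fmul q p) = frac (1, 0).
Proof.
case: p => m j; have [l [n mn]] := delta_lmultiple m.
exists (D ^+ j * n, l); split; apply/fracP => /=.
  rewrite iter_gphiM iter_gphi_deltaX gdeltaXC mulgA mn expg0 mulg1 mul1g.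
  by rewrite -expgnDr addnC.
have -> : D ^+ j * n * phi l m = D ^+ j * D ^+ l.
  rewrite -mulgA; congr (_ * _).
  by apply: (lcancel gG (a := m)); rewrite mulgA mn gdeltaXC.
by rewrite expg0 mulg1 mul1g -expgnDr addnC.
Qed.

Definition fracs_rep (x : fracs) : M * nat := projT1 (cid (frac_repr x)).
Lemma fracs_repK x : frac (fracs_rep x) = x.
Proof. by rewrite /fracs_rep; case: cid. Qed.

Definition fracs_mul (x y : fracs) : fracs :=
  frac (fmul (fracs_rep x) (fracs_rep y)).
Definition fracs_inv (x : fracs) : fracs :=
  frac (projT1 (cid (fmul_inv (fracs_rep x)))).

Lemma fracs_mulE p q : fracs_mul (frac p) (frac q) = frac (fmul p q).
Proof. by apply: fmul_frac; rewrite fracs_repK. Qed.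

Lemma fracs_mulA : associative fracs_mul.
Proof.
move=> x y z; rewrite -(fracs_repK x) -(fracs_repK y) -(fracs_repK z).
by rewrite !fracs_mulE fmulA.
Qed.

Lemma fracs_mul1 : left_id (frac (1, 0)) fracs_mul.
Proof. by move=> x; rewrite -(fracs_repK x) fracs_mulE fmul1p. Qed.

Lemma fracs_1mul : right_id (frac (1, 0)) fracs_mul.
Proof. by move=> x; rewrite -(fracs_repK x) fracs_mulE fmulp1. Qed.

Lemma fracs_mulV : right_inverse (frac (1, 0)) fracs_inv fracs_mul.
Proof.
move=> x; rewrite -{1}(fracs_repK x) fracs_mulE.
by case: cid => q [].
Qed.

Lemma fracs_Vmul : left_inverse (frac (1, 0)) fracs_inv fracs_mul.
Proof.
move=> x; rewrite -{2}(fracs_repK x) fracs_mulE.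
by case: cid => q [].
Qed.

HB.instance Definition _ := isGroup.Build fracs
  fracs_mulA fracs_mul1 fracs_1mul fracs_Vmul fracs_mulV.

Definition to_fracs (m : M) : fracs := frac (m, 0).

Lemma to_fracsM : {morph to_fracs : a b / a * b}.
Proof. by move=> a b; rewrite [RHS]fracs_mulE. Qed.

HB.instance Definition _ := isMultiplicative.Build M fracs to_fracs to_fracsM.

Variables (A : groupType) (iota : {multiplicative M -> A}).
Hypothesis hA : is_group_of_formal_inverses iota.

Lemma iota_inj : injective iota.
Proof.
move=> a b ab; have [[g gP] _] := hA to_fracs.
have : to_fracs a = to_fracs b by rewrite -(gP a) -(gP b) /= ab.
by move/fracP; rewrite /= !expg0 !mulg1.
Qed.

Definition of_frac (p : M * nat) : A := iota p.1 * (iota (D ^+ p.2))^-1.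

Lemma of_frac_eq p q : frac p = frac q -> of_frac p = of_frac q.
Proof.
move/fracP => pq; have DC : iota (D ^+ p.2) * iota (D ^+ q.2) =
    iota (D ^+ q.2) * iota (D ^+ p.2).
  by rewrite -!gmulfM -!expgnDr addnC.
apply: (mulIg (iota (D ^+ p.2) * iota (D ^+ q.2))).
by rewrite {2}DC /of_frac !mulgA !mulgVK -!gmulfM pq.
Qed.

Definition of_fracs (x : fracs) : A := of_frac (fracs_rep x).

Lemma of_fracsM : {morph of_fracs : x y / x * y}.
Proof.
move=> x y; rewrite -[x in LHS]fracs_repK -[y in LHS]fracs_repK [_ * _]fracs_mulE.
rewrite {1}/of_fracs (of_frac_eq (fracs_repK _)) /of_fracs.
move: (fracs_rep x) (fracs_rep y) => [m j] [n k].
rewrite /of_frac /= gmulfM -!mulgA; congr (_ * _).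
rewrite addnC expgnDr gmulfM invgM !mulgA; congr (_ * _).
apply: (mulgI (iota (D ^+ j))); apply: (mulIg (iota (D ^+ j))).
by rewrite !mulgA mulgVK -gmulfM gdeltaXC gmulfM mulgV mul1g.
Qed.

HB.instance Definition _ := isMultiplicative.Build fracs A of_fracs of_fracsM.

Lemma iota_frac (x : A) : exists m k, x = iota m * (iota (D ^+ k))^-1.
Proof.
have [[g gP] _] := hA to_fracs; have [_ uniq] := hA iota.
have := uniq (of_fracs \o g) idfun.
have gK : (of_fracs \o g) \o iota =1 iota.
  move=> m; have gm : g (iota m) = to_fracs m := gP m.
  rewrite /= gm /of_fracs (of_frac_eq (fracs_repK _)) /of_frac /=.
  by rewrite expg0 iota1 invg1 mulg1.
move=> /(_ gK (fun=> erefl) x) /= <-.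
by exists (fracs_rep (g x)).1, (fracs_rep (g x)).2.
Qed.

End Fractions.

(** * Reduced ribbons *)

Section Reduced.
Variables (M : monoidType) (G : garside_data (monoid_cat M)).
Hypothesis gG : garside_structure G.
Variables (A : groupType) (iota : {multiplicative M -> A}).
Hypothesis hA : is_group_of_formal_inverses iota.
Implicit Types X Y Z : parab G.

Let injI := iota_inj gG hA.

Definition ribbon X Y (g : M) : Prop := is_ribbon iota X Y (iota g).

Lemma ribbonP X Y g : ribbon X Y g <->
  (forall x, sval X x -> exists2 y, sval Y y & x * g = g * y) /\
  (forall y, sval Y y -> exists2 x, sval X x & x * g = g * y).
Proof.
have conjE x y : iota x ^ iota g = iota y <-> x * g = g * y.
  rewrite conjgE; split=> [/(congr1 (fun z => iota g * z))|xg].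
    by rewrite mulVKg -!gmulfM => /injI.
  by rewrite -gmulfM xg gmulfM mulKg.
split=> [/predeqP XY|[XY YX]].
  split=> [x Xx|y Yy].
    have [|y Yy yx] := (XY (iota x ^ iota g)).1 _.
      by exists (iota x) => //; exists x.
    by exists y => //; apply/conjE.
  have [|_ [x Xx <-] xy] := (XY (iota y)).2 _; first by exists y.
  by exists x => //; apply/conjE.
apply/predeqP => a; split=> [[_ [x Xx <-] <-]|[y Yy <-]].
  by have [y Yy /conjE->] := XY x Xx; exists y.
by have [x Xx /conjE<-] := YX y Yy; exists (iota x) => //; exists x.
Qed.

Lemma parab_elem X : exists d, elem_parabolic G (sval X) d.
Proof. exact: parabolic_elem gG _ (svalP X). Qed.

Lemma parab1 X : sval X 1.
Proof. by have [d [[]]] := parab_elem X. Qed.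

Lemma parabM X a b : sval X a -> sval X b -> sval X (a * b).
Proof. by have [d [[_ H] _ _ _ _ _ _]] := parab_elem X; exact: H. Qed.

Lemma parab_factor X a b : sval X (a * b) -> sval X a /\ sval X b.
Proof. by have [d [_ H _ _ _ _ _]] := parab_elem X; exact: H. Qed.

Lemma parab_ljoin X a b : sval X a -> sval X b -> exists j,
  [/\ sval X j, lle a j, lle b j & forall c, lle a c -> lle b c -> lle j c].
Proof. by have [d hX] := parab_elem X; exact: ep_ljoin hX. Qed.

Lemma parab_rjoin X a b : sval X a -> sval X b -> exists j,
  [/\ sval X j, rle a j, rle b j & forall c, rle a c -> rle b c -> rle j c].
Proof. by have [d hX] := parab_elem X; exact: ep_rjoin hX. Qed.

Lemma iota_std X x : sval X x -> std iota X (iota x).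
Proof. by move=> Xx H [_]; apply; exists x. Qed.

Lemma stdM X a b : std iota X a -> std iota X b -> std iota X (a * b).
Proof. by have [_ H _] := subgroup_std iota X; exact: H. Qed.

Lemma stdV X a : std iota X a -> std iota X a^-1.
Proof. by have [_ _ H] := subgroup_std iota X; exact: H. Qed.

Lemma std_rfrac X a : std iota X a -> exists x1 x2,
  [/\ sval X x1, sval X x2 & a = iota x1 * (iota x2)^-1].
Proof.
move=> Xa; apply: (Xa [set a | exists x1 x2,
  [/\ sval X x1, sval X x2 & a = iota x1 * (iota x2)^-1]]); split; last first.
  move=> _ [x Xx <-]; exists x, 1; split=> //; first exact: parab1.
  by rewrite iota1 invg1 mulg1.
split.
- by exists 1, 1; split; rewrite ?mulgV //; exact: parab1.
- move=> _ _ [x1 [x2 [X1 X2 ->]]] [y1 [y2 [Y1 Y2 ->]]].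
  have [j [Xj [u ju] [v jv] _]] := parab_ljoin X2 Y1.
  have [_ Xu] : sval X x2 /\ sval X u by apply: parab_factor; rewrite -ju.
  have [_ Xv] : sval X y1 /\ sval X v by apply: parab_factor; rewrite -jv.
  exists (x1 * u), (y2 * v); split; [exact: parabM|exact: parabM|].
  apply: (mulIg (iota (y2 * v))); rewrite mulgVK !gmulfM !mulgA mulgVK.
  by rewrite -[LHS]mulgA -[X in _ * X = _]gmulfM -jv ju gmulfM -!mulgA mulKg.
- move=> _ [x1 [x2 [X1 X2 ->]]]; exists x2, x1; split=> //.
  by rewrite invgM invgK.
Qed.

Lemma std_lfrac X a : std iota X a -> exists x1 x2,
  [/\ sval X x1, sval X x2 & a = (iota x2)^-1 * iota x1].
Proof.
move=> /std_rfrac[x1 [x2 [X1 X2 ->]]].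
have [j [Xj [u ju] [v jv] _]] := parab_rjoin X1 X2.
have [Xu _] : sval X u /\ sval X x1 by apply: parab_factor; rewrite -ju.
have [Xv _] : sval X v /\ sval X x2 by apply: parab_factor; rewrite -jv.
exists v, u; split=> //; apply: (mulgI (iota u)); apply: (mulIg (iota x2)).
by rewrite mulVKg !mulgA mulgVK -!gmulfM -ju jv.
Qed.

Lemma std_conjP X Y g : is_std_conj iota X Y g <->
  (forall a, std iota X a -> std iota Y (a ^ g)) /\
  (forall a, std iota Y a -> std iota X (a ^ g^-1)).
Proof.
split=> [XY|[XY YX]].
  split=> a Ha; first by rewrite -XY; exists a.
  by rewrite -(is_std_conjV XY); exists a.
apply/predeqP => a; split=> [[b Xb <-]|Ya]; first exact: XY.
by exists (a ^ g^-1); [exact: YX | rewrite conjgKV].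
Qed.

Lemma std_conj_id X a : std iota X a -> is_std_conj iota X X a.
Proof.
by move=> Xa; apply/std_conjP; split=> b Xb; rewrite conjgE ?invgK;
  do ?[apply: stdM|apply: stdV].
Qed.

Definition reduced X (g : M) : Prop := forall x, sval X x -> lle x g -> x = 1.
Definition rreduced X (g : M) : Prop := forall x, sval X x -> rle x g -> x = 1.

Lemma reduced1 X : reduced X 1.
Proof. by move=> x _ /(lle_eq1 gG). Qed.

Lemma reduced_lle X g h : reduced X h -> lle g h -> reduced X g.
Proof. by move=> rh gh x Xx xg; apply: rh => //; exact: lle_trans gh. Qed.

Lemma reduced_decomp X g : exists a b, [/\ sval X a, reduced X b & g = a * b].
Proof.
elim/(well_founded_ind (proper_factor_wf gG)): g => g IH.
have [rg|/existsNP[x /not_implyP[Xx /not_implyP[[h gxh] x1]]]] := EM (reduced X g).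
  by exists 1, g; split=> //; [exact: parab1 | rewrite mul1g].
have [|a [b [Xa rb hab]]] := IH h; first by rewrite gxh; exact: (proper_factor_mull gG).
by exists (x * a), b; split=> //; [exact: parabM | rewrite gxh hab mulgA].
Qed.

Lemma rreduced_decomp X g : exists b a, [/\ sval X a, rreduced X b & g = b * a].
Proof.
elim/(well_founded_ind (proper_factor_wf gG)): g => g IH.
have [rg|/existsNP[x /not_implyP[Xx /not_implyP[[h gxh] x1]]]] := EM (rreduced X g).
  by exists g, 1; split=> //; [exact: parab1 | rewrite mulg1].
have [|b [a [Xa rb hab]]] := IH h; first by rewrite gxh; exact: (proper_factor_mulr gG).
by exists b, (a * x); split=> //; [exact: parabM | rewrite gxh hab mulgA].
Qed.

(* Clearing denominators in b^-1 x b = z1 z2^-1 gives x b z2 = b z1; a common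
   left-multiple of z1 and z2 then right-divides b z1, so it is z1 up to a right
   divisor of b lying in Y, which is trivial. *)
Lemma std_conj_ribbon X Y b : reduced X b -> rreduced Y b ->
  is_std_conj iota X Y (iota b) -> ribbon X Y b.
Proof.
move=> lb rb /std_conjP[XY YX]; apply/ribbonP; split=> [x Xx|y Yy].
  have [z1 [z2 [Y1 Y2 e]]] := std_rfrac (XY _ (iota_std Xx)).
  have {}e : x * b * z2 = b * z1.
    apply: injI; rewrite !gmulfM; apply: (mulgI (iota b)^-1).
    by rewrite !mulgA -(mulgA _ (iota x)) -conjgE e mulgVK mulVg mul1g.
  have [j [Yj [w jw] [v jv] jc]] := parab_rjoin Y1 Y2.
  have [q bq] : rle j (b * z1) by apply: jc; [exists b | exists (x * b)].
  have [Yw _] : sval Y w /\ sval Y z1 by apply: parab_factor; rewrite -jw.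
  have [Yv _] : sval Y v /\ sval Y z2 by apply: parab_factor; rewrite -jv.
  have bqw : b = q * w by apply: (rcancel gG (a := z1)); rewrite bq jw mulgA.
  have w1 : w = 1 by apply: rb => //; exists q.
  exists v => //; apply: (rcancel gG (a := z2)).
  by rewrite e -mulgA -jv jw w1 mul1g.
have [x1 [x2 [X1 X2 e]]] := std_lfrac (YX _ (iota_std Yy)).
have {}e : x2 * (b * y) = x1 * b.
  apply: injI; rewrite !gmulfM; apply: (mulIg (iota b)^-1).
  apply: (mulgI (iota x2)^-1); rewrite !mulgA mulgK mulVg mul1g -e conjgE invgK.
  by rewrite !mulgA.
have [j [Xj [w jw] [v jv] jc]] := parab_ljoin X1 X2.
have [q bq] : lle j (x1 * b).
  by apply: jc; [exists b | rewrite -e; exists (b * y)].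
have [_ Xw] : sval X x1 /\ sval X w by apply: parab_factor; rewrite -jw.
have [_ Xv] : sval X x2 /\ sval X v by apply: parab_factor; rewrite -jv.
have bqw : b = w * q by apply: (lcancel gG (a := x1)); rewrite bq jw mulgA.
have w1 : w = 1 by apply: lb => //; exists q.
exists v => //; apply: (lcancel gG (a := x2)).
by rewrite e mulgA -jv jw w1 mulg1.
Qed.

Lemma std_conj_decomp X Y g : is_std_conj iota X Y (iota g) ->
  exists a b, [/\ sval X a, reduced X b, ribbon X Y b & g = a * b].
Proof.
move=> XY; have [a [b [Xa rb gab]]] := reduced_decomp X g.
have [b' [c [Yc rb' bbc]]] := rreduced_decomp Y b.
have lb' : reduced X b' by apply: reduced_lle rb _; exists c.
have rib : ribbon X Y b'.
  apply: std_conj_ribbon => //.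
  have -> : iota b' = (iota a)^-1 * (iota g * (iota c)^-1).
    by rewrite gab bbc !gmulfM -!mulgA mulgV mulg1 mulKg.
  apply: is_std_conjM (std_conj_id (stdV (iota_std Xa))) _.
  exact: is_std_conjM XY (std_conj_id (stdV (iota_std Yc))).
have [_ /(_ c Yc)[c' Xc' cc]] := (ribbonP _ _ _).1 rib.
by exists (a * c'), b'; split=> //; [exact: parabM | rewrite gab bbc -mulgA cc].
Qed.

Lemma ribbon1 X : ribbon X X 1.
Proof. by rewrite /ribbon iota1; exact: is_ribbon1. Qed.

Lemma ribbonM X Y Z g h : ribbon X Y g -> ribbon Y Z h -> ribbon X Z (g * h).
Proof. by rewrite /ribbon gmulfM; exact: is_ribbonM. Qed.

Lemma ribbon_lcancel X Y Z g h : ribbon X Y g -> ribbon X Z (g * h) -> ribbon Y Z h.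
Proof.
move=> XY XZ; rewrite /ribbon -(mulKg (iota g) (iota h)) -gmulfM.
exact: is_ribbonM (is_ribbonV XY) XZ.
Qed.

Lemma ribbon_rcancel X Y Z g h : ribbon Y Z h -> ribbon X Z (g * h) -> ribbon X Y g.
Proof.
move=> YZ XZ; rewrite /ribbon -(mulgK (iota h) (iota g)) -gmulfM.
exact: is_ribbonM XZ (is_ribbonV YZ).
Qed.

Lemma ribbon_decomp X Y g : ribbon X Y g ->
  exists a b, [/\ sval X a, reduced X b, ribbon X Y b & g = a * b].
Proof. by move/ribbon_std_conj; exact: std_conj_decomp. Qed.

Lemma reduced_lle_mul X x x' b : reduced X b -> sval X x -> sval X x' ->
  lle x (x' * b) -> lle x x'.
Proof.
move=> rb Xx Xx' xb; have [j [Xj xj [w jw] jc]] := parab_ljoin Xx Xx'.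
have jb := jc _ xb (lle_mulr _ _).
have [_ Xw] : sval X x' /\ sval X w by apply: parab_factor; rewrite -jw.
have w1 : w = 1 by apply: rb => //; apply: (@lle_mul2lE _ _ gG x'); rewrite -jw.
by move: xj; rewrite jw w1 mulg1.
Qed.

Lemma reduced_decomp_uniq X a a' b b' : sval X a -> sval X a' ->
  reduced X b -> reduced X b' -> a * b = a' * b' -> a = a' /\ b = b'.
Proof.
move=> Xa Xa' rb rb' e.
have aa : a = a'.
  apply: (lle_anti gG).
    by apply: (reduced_lle_mul rb'); rewrite // -e; exact: lle_mulr.
  by apply: (reduced_lle_mul rb); rewrite // e; exact: lle_mulr.
by split=> //; apply: (lcancel gG (a := a)); rewrite e aa.
Qed.

Lemma reducedM X Y b c : ribbon X Y b -> reduced X b -> reduced Y c ->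
  reduced X (b * c).
Proof.
move=> /ribbonP[XY YX] rb rc x Xx xbc; have [y Yy xy] := XY x Xx.
have [j [xj [u ju] jc]] := ljoin gG x b.
have [v yv] : lle u y.
  apply: (@lle_mul2lE _ _ gG b); rewrite -ju -xy.
  by apply: jc; [exact: lle_mulr | exists y].
have [Yu Yv] : sval Y u /\ sval Y v by apply: parab_factor; rewrite -yv.
have [x' Xx' xu] := YX u Yu.
have xx' : lle x x' by apply: (reduced_lle_mul rb); rewrite // xu -ju.
have x'x : lle x' x.
  apply: (reduced_lle_mul rb); rewrite // xy yv mulgA -xu -mulgA; exact: lle_mulr.
have e := lle_anti gG xx' x'x.
have uy : u = y by apply: (lcancel gG (a := b)); rewrite -xu -xy e.
have y1 : y = 1.
  apply: rc => //; rewrite -uy; apply: (@lle_mul2lE _ _ gG b).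
  by rewrite -ju; apply: jc => //; exact: lle_mulr.
by apply: (rcancel gG (a := b)); rewrite xy y1 mulg1 mul1g.
Qed.

Lemma reduced_rfactor X Y b c : ribbon X Y b -> reduced X (b * c) -> reduced Y c.
Proof.
move=> /ribbonP[_ YX] r y Yy yc; have [x Xx xy] := YX y Yy.
have x1 : x = 1.
  apply: r => //; apply: lle_trans (lle_mul2l b yc).
  by rewrite -xy; exact: lle_mulr.
by apply: (lcancel gG (a := b)); rewrite -xy x1 mulg1 mul1g.
Qed.

(* [g = a b] -> [b] is a functorial retraction of the ribbons onto the reduced
   ones; the next two lemmas are its compatibility with divisibility. *)
Lemma reduced_lle_proj X Y Z g h a b : ribbon X Y g -> reduced X g ->
  ribbon X Z h -> sval X a -> reduced X b -> h = a * b -> lle g h -> lle g b.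
Proof.
move=> XY rg XZ Xa rb hab [u hu].
have YZ : ribbon Y Z u by apply: (ribbon_lcancel XY); rewrite -hu.
have [u1 [u2 [Yu1 ru2 _ uu]]] := ribbon_decomp YZ.
have [_ /(_ u1 Yu1)[x Xx xu]] := (ribbonP _ _ _).1 XY.
have [] := @reduced_decomp_uniq X a x b (g * u2).
- by [].
- by [].
- by [].
- exact: reducedM XY rg ru2.
- by rewrite -hab hu uu !mulgA xu.
by move=> _ ->; exact: lle_mulr.
Qed.

Lemma reduced_rle_proj X Y Z g h a b : ribbon Y Z g -> reduced Y g ->
  ribbon X Z h -> sval X a -> reduced X b -> h = a * b -> rle g h -> rle g b.
Proof.
move=> YZ rg XZ Xa rb hab [u hu].
have XY : ribbon X Y u by apply: (ribbon_rcancel YZ); rewrite -hu.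
have [u1 [u2 [Xu1 ru2 ru uu]]] := ribbon_decomp XY.
have [] := @reduced_decomp_uniq X a u1 b (u2 * g).
- by [].
- by [].
- by [].
- exact: reducedM ru ru2 rg.
- by rewrite -hab hu uu !mulgA.
by move=> _ ->; exists u2.
Qed.

End Reduced.

(** * Lattices of ribbons *)

Section LocalLattice.
Variables (C : category) (T : Type) (lt : T -> T -> Prop).
Variables (len : forall x y : C, hom x y -> T).
Variables (triv : forall x y : C, hom x y -> Prop).
Variables (good : forall x : C, under x -> Prop).
Arguments len {x y}.
Arguments triv {x y}.
Arguments good {x}.
Local Open Scope cat_scope.

Hypothesis lt_wf : well_founded lt.
Hypothesis comp_cancel : forall (x y z : C) (u : hom x y) (v w : hom y z),
  u >> v = u >> w -> v = w.
Hypothesis triv_ldiv : forall (x y : C) (f : hom x y) (c : under x),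
  triv f -> ldiv (mk_under f) c.
Hypothesis triv_factor : forall (x y z : C) (f : hom x y) (g : hom y z),
  triv (f >> g) -> triv f.
Hypothesis len_lt : forall (x y z : C) (f : hom x y) (g : hom y z),
  ~ triv f -> lt (len g) (len (f >> g)).
Hypothesis good_ldiv : forall (x : C) (g : under x), ~ triv (tagged g) ->
  exists a, [/\ good a, ~ triv (tagged a) & ldiv a g].
Hypothesis good_join : forall (x : C) (a b : under x), good a -> good b ->
  exists j, is_join (@ldiv C x) a b j.
Hypothesis ldiv_bound : forall (x : C) (a b : under x),
  exists c, ldiv a c /\ ldiv b c.

Let ldiv_refl (x : C) (a : under x) : ldiv a a.
Proof. by exists (idm _); rewrite compm1. Qed.

Let ldiv_trans (x : C) (b a c : under x) : ldiv a b -> ldiv b c -> ldiv a c.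
Proof. by move=> [u ab] [v bc]; exists (u >> v); rewrite bc ab Defs.compA. Qed.

Let pre (x y : C) (u : hom x y) (g : under y) : under x :=
  mk_under (u >> tagged g).

Let ldiv_pre (x y : C) (u : hom x y) (g h : under y) :
  ldiv (pre u g) (pre u h) <-> ldiv g h.
Proof.
split=> -[w] /= e; exists w; last by rewrite /= e Defs.compA.
by apply: (@comp_cancel _ _ _ u); rewrite e Defs.compA.
Qed.

Let ldivE (x y : C) (u : hom x y) (g : under x) :
  ldiv (mk_under u) g -> exists g', g = pre u g'.
Proof. by case: g => z v [w /= vw]; exists (mk_under w); rewrite /pre /= -vw. Qed.

Let is_join_pre (x y : C) (u : hom x y) (g h j : under y) :
  is_join (@ldiv C _) g h j -> is_join (@ldiv C _) (pre u g) (pre u h) (pre u j).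
Proof.
move=> [gj hj jc]; split; [exact/ldiv_pre|exact/ldiv_pre|move=> c gc].
have [c' cE] : exists c', c = pre u c'.
  by apply: ldivE; apply: ldiv_trans gc; exists (tagged g).
by move: gc; rewrite cE => /ldiv_pre gc /ldiv_pre hc; apply/ldiv_pre/jc.
Qed.

Lemma local_join (x : C) (g h : under x) : exists j, is_join (@ldiv C x) g h j.
Proof.
have [N [gN hN]] := ldiv_bound g h.
have [t tN] : exists t, t = len (tagged N) by eexists.
elim/(well_founded_ind lt_wf): t x g h N tN gN hN => t IH x g h N tN gN hN.
have [tg|ntg] := EM (triv (tagged g)).
  exists h; split=> //; case: g tg {gN} => y v; exact: triv_ldiv.
have [th|nth] := EM (triv (tagged h)).
  exists g; split=> //; case: h th {hN} => y v; exact: triv_ldiv.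
have [[y u] [gu ntu ug]] := good_ldiv ntg.
have [[z v] [gv ntv vh]] := good_ldiv nth.
have [[w p] [up vp jp]] := good_join gu gv.
have pN : ldiv (mk_under p) N.
  by apply: jp; [exact: ldiv_trans gN | exact: ldiv_trans hN].
have half (y' : C) (u' : hom x y') (k : under x) : ~ triv u' ->
    ldiv (mk_under u') k -> ldiv k N -> ldiv (mk_under u') (mk_under p) ->
    exists k', is_join (@ldiv C x) k (mk_under p) (pre p k').
  move=> ntu' uk kN up'.
  have [N1 NE] := ldivE (ldiv_trans uk kN); have [k1 kE] := ldivE uk.
  have [q pE] := ldivE up'.
  have [j /(is_join_pre u')] : exists j, is_join (@ldiv C y') k1 q j.
    apply: (IH (len (tagged N1)) _ _ k1 q N1 erefl).
    - by rewrite tN NE; exact: len_lt.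
    - by move: kN; rewrite kE NE => /ldiv_pre.
    - by move: pN; rewrite pE NE => /ldiv_pre.
  rewrite -kE -pE => Hj; have [_ pj _] := Hj.
  by have [k' jE] := ldivE pj; exists k'; rewrite -jE.
have [k1 [gk1 _ k1c]] := half _ _ _ ntu ug gN up.
have [k2 [hk2 _ k2c]] := half _ _ _ ntv vh hN vp.
have [N2 NE] := ldivE pN.
have [k [k1k k2k kc]] : exists k, is_join (@ldiv C w) k1 k2 k.
  apply: (IH (len (tagged N2)) _ _ k1 k2 N2 erefl).
  - rewrite tN NE; apply: len_lt => tp; apply: ntu.
    by case: up => q; rewrite /= => pE; move: tp; rewrite pE => /triv_factor.
  - by apply/(ldiv_pre p); rewrite -NE; exact: k1c.
  - by apply/(ldiv_pre p); rewrite -NE; exact: k2c.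
exists (pre p k); split.
- by apply: ldiv_trans gk1 _; exact/ldiv_pre.
- by apply: ldiv_trans hk2 _; exact/ldiv_pre.
move=> c gc hc.
have pc : ldiv (mk_under p) c by apply: jp; [exact: ldiv_trans gc|exact: ldiv_trans hc].
have [c' cE] := ldivE pc; have := k1c c gc pc; have := k2c c hc pc.
by rewrite cE => /ldiv_pre ? /ldiv_pre ?; apply/ldiv_pre/kc.
Qed.

Lemma local_meet (x : C) (g h : under x) : exists m, is_meet (@ldiv C x) g h m.
Proof.
pose common (d : under x) := ldiv d g /\ ldiv d h.
have [t [d [q [tq gq cd]]]] : exists t, exists d : under x,
    exists q : hom (tag d) (tag g),
    [/\ t = len q, tagged g = tagged d >> q & common d].
  exists (len (tagged g)), (mk_under (idm x)), (tagged g).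
  by split; rewrite ?comp1m //; split; eexists; rewrite comp1m.
elim/(well_founded_ind lt_wf): t d q tq gq cd => t IH d q tq gq [dg dh].
have [cd|/existsNP[c /not_implyP[[cg ch] ncd]]] := EM (forall c, common c -> ldiv c d).
  by exists d; split=> // c cg ch; apply: cd.
have [e [ce [w ew] ec]] := local_join c d.
have eg := ec _ cg dg; have eh := ec _ ch dh.
have [q' eq'] := eg.
have qE : q = w >> q'.
  by apply: (@comp_cancel _ _ _ (tagged d)); rewrite Defs.compA -ew -gq.
have ntw : ~ triv w.
  move=> /(triv_ldiv (mk_under (idm _)))[w' /= ww']; apply: ncd.
  apply: ldiv_trans ce _; exists w'.
  by rewrite ew -Defs.compA -ww' compm1.
apply: (IH (len q') _ e q') => //.
by rewrite tq qE; exact: len_lt.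
Qed.

End LocalLattice.

Definition op_category (C : category) : category :=
  @Category C (fun x y => @hom C y x) (@idm C)
    (fun x y z v w => @Defs.comp C z y x w v)
    (fun x y => @compm1 C y x) (fun x y => @comp1m C y x)
    (fun x y z t f g h => esym (Defs.compA h g f)).

Section RibbonLattice.
Variables (M : monoidType) (G : garside_data (monoid_cat M)).
Hypothesis gG : garside_structure G.
Variables (A : groupType) (iota : {multiplicative M -> A}).
Hypothesis hA : is_group_of_formal_inverses iota.
Local Notation R := (ribbon_category G iota).
Local Notation D := (gdelta G).
Implicit Types X Y Z : R.

Lemma ribbon_ldivP X (a b : under X) :
  ldiv a b <-> lle (sval (tagged a)) (sval (tagged b)).
Proof.
case: a b => [Y [g XY]] [Z [h XZ]]; split=> [[u /= /(congr1 sval)/= hu]|[u /= hu]].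
  by exists (sval u).
have YZ : ribbon iota Y Z u by apply: (ribbon_lcancel XY); rewrite -hu.
by exists (exist _ u YZ); apply: sval_inj.
Qed.

Lemma ribbon_rdivP X (a b : Defs.over X) :
  rdiv a b <-> rle (sval (tagged a)) (sval (tagged b)).
Proof.
case: a b => [Y [g YX]] [Z [h ZX]]; split=> [[u /= /(congr1 sval)/= hu]|[u /= hu]].
  by exists (sval u).
have ZY : ribbon iota Z Y u by apply: (ribbon_rcancel YX); rewrite -hu.
by exists (exist _ u ZY); apply: sval_inj.
Qed.

Definition Phi_parab_inv X : R :=
  exist _ _ (parabolic_gphi_preimage gG (svalP X)).

Lemma Phi_parab_invK X : Phi_parab gG (Phi_parab_inv X) = X.
Proof.
have [E FK EK] := gphi_bij gG.
apply: sval_inj; apply/predeqP => m; split=> [[n Xn <-]|Xm]; first exact: Xn.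
by exists (E m); [rewrite /preimage /= EK | exact: EK].
Qed.

Lemma Phi_parabK X : Phi_parab_inv (Phi_parab gG X) = X.
Proof.
apply: sval_inj; apply/predeqP => m; split=> [[n Xn]|Xm]; last by exists m.
by move=> /(gphi_inj gG) <-.
Qed.

Lemma ribbon_deltaX k X : exists Y : R, ribbon iota X Y (D ^+ k).
Proof.
elim: k X => [|k IH] X; first by exists X; exact: ribbon1.
have [Y XY] := IH (Phi_parab gG X); exists Y.
by rewrite expgS; apply: ribbonM XY; exact: Delta_ribbon.
Qed.

Lemma ribbon_deltaX_to k X : exists Y : R, ribbon iota Y X (D ^+ k).
Proof.
elim: k X => [|k IH] X; first by exists X; exact: ribbon1.
have [Y YX] := IH (Phi_parab_inv X); exists Y.
rewrite expgSr; apply: ribbonM YX _.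
by have := Delta_ribbon gG iota (Phi_parab_inv X); rewrite Phi_parab_invK.
Qed.

Lemma ribbon_identity X Y (g : @hom R X Y) :
  sval g = 1 -> is_identity g.
Proof.
case: g => g XY /= g1; have e : X = Y.
  apply: sval_inj; apply/predeqP => m.
  have [H1 H2] := (ribbonP gG hA X Y g).1 XY.
  split=> Hm; first by have [n Hn] := H1 m Hm; rewrite g1 mul1g mulg1 => ->.
  by have [n Hn] := H2 m Hm; rewrite g1 mul1g mulg1 => <-.
case: Y / e XY => XX; exists X; congr mk_arrow; exact: sval_inj.
Qed.

Lemma ribbon_atom_neq1 X Y (g : @hom R X Y) : atom g -> sval g <> 1.
Proof. by move=> [ng _] /ribbon_identity. Qed.

Hypothesis hnu : has_nu_structure G iota.

Lemma ribbon_ljoin X (a b : under X) :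
  (exists m, is_meet (@ldiv R X) a b m) /\ (exists j, is_join (@ldiv R X) a b j).
Proof.
have [hnuf _] := hnu; pose nu X := projT1 (cid (hnuf X)).
have nuP X : is_nu (nu X) := projT2 (cid (hnuf X)).
pose len (X Y : R) (g : hom X Y) : M := sval g.
pose triv (X Y : R) (g : hom X Y) : Prop := sval g = 1.
pose good (X : R) (g : under X) : Prop := exists s, g = nu X s.
have H1 (x y z : R) (u : hom x y) (v w : hom y z) : (u >> v = u >> w)%cat -> v = w.
  by move=> /(congr1 sval)/= /(lcancel gG)/sval_inj.
have H2 (x y : R) (f : hom x y) (c : under x) : triv _ _ f -> ldiv (mk_under f) c.
  by move=> f1; apply/ribbon_ldivP; rewrite /= f1; exact: lle1.
have H3 (x y z : R) (f : hom x y) (g : hom y z) : triv _ _ (f >> g)%cat -> triv _ _ f.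
  by move=> /(mul_eq1 gG)[].
have H4 (x y z : R) (f : hom x y) (g : hom y z) :
    ~ triv _ _ f -> proper_factor (len _ _ g) (len _ _ (f >> g)%cat).
  exact: (proper_factor_mull gG).
have H5 (x : R) (g : under x) : ~ triv _ _ (tagged g) ->
    exists a, [/\ good _ a, ~ triv _ _ (tagged a) & ldiv a g].
  move=> /(lle_atom gG)[s [c [sa gE]]]; have [n1 n2 _] := nuP x.
  exists (nu x (exist _ s sa)); split; first by eexists.
    by apply: ribbon_atom_neq1; exact: n1.
  by apply: n2; exists c.
have H6 (x : R) (g h : under x) : good _ g -> good _ h ->
    exists j, is_join (@ldiv R x) g h j.
  move=> [s ->] [t ->]; have [_ _ /(_ s t)[j [sj tj jc] [Y xY]]] := nuP x.
  exists (@mk_under R x Y (exist _ j xY)).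
  split; [exact/ribbon_ldivP|exact/ribbon_ldivP|].
  move=> c /ribbon_ldivP sc /ribbon_ldivP tc; apply/ribbon_ldivP.
  exact: (jc (mon_under _) sc tc).
have H7 (x : R) (g h : under x) : exists c, ldiv g c /\ ldiv h c.
  have [k [u gu]] := delta_lmultiple gG (sval (tagged g)).
  have [l [v hv]] := delta_lmultiple gG (sval (tagged h)).
  have [Y xY] := ribbon_deltaX (k + l) x.
  exists (@mk_under R x Y (exist _ _ xY)); split; apply/ribbon_ldivP => /=.
    by rewrite expgnDr -gu -mulgA; exact: lle_mulr.
  by rewrite addnC expgnDr -hv -mulgA; exact: lle_mulr.
by split; [apply: (local_meet (proper_factor_wf gG) H1 H2 H3 H4 H5 H6 H7) |
           apply: (local_join (proper_factor_wf gG) H1 H2 H3 H4 H5 H6 H7)].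
Qed.

Lemma ribbon_rjoin X (a b : Defs.over X) :
  (exists m, is_meet (@rdiv R X) a b m) /\ (exists j, is_join (@rdiv R X) a b j).
Proof.
have [_ hnuf] := hnu; pose nu X := projT1 (cid (hnuf X)).
have nuP X : is_nu_tilde (nu X) := projT2 (cid (hnuf X)).
pose C := op_category R.
pose len (X Y : C) (g : hom X Y) : M := sval g.
pose triv (X Y : C) (g : hom X Y) : Prop := sval g = 1.
pose good (X : C) (g : under X) : Prop := exists s, g = nu X s.
have H1 (x y z : C) (u : hom x y) (v w : hom y z) : (u >> v = u >> w)%cat -> v = w.
  by move=> /(congr1 sval)/= /(rcancel gG)/sval_inj.
have H2 (x y : C) (f : hom x y) (c : under x) : triv _ _ f -> ldiv (mk_under f) c.
  move=> f1; apply/(@ribbon_rdivP x (mk_over (f : @hom R y x)) c).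
  by rewrite /= f1; exists (sval (tagged c)); rewrite mulg1.
have H3 (x y z : C) (f : hom x y) (g : hom y z) : triv _ _ (f >> g)%cat -> triv _ _ f.
  by move=> /(mul_eq1 gG)[].
have H4 (x y z : C) (f : hom x y) (g : hom y z) :
    ~ triv _ _ f -> proper_factor (len _ _ g) (len _ _ (f >> g)%cat).
  exact: (proper_factor_mulr gG).
have H5 (x : C) (g : under x) : ~ triv _ _ (tagged g) ->
    exists a, [/\ good _ a, ~ triv _ _ (tagged a) & ldiv a g].
  move=> /(rle_atom gG)[s [c [sa gE]]]; have [n1 n2 _] := nuP x.
  exists (nu x (exist _ s sa)); split; first by eexists.
    by apply: ribbon_atom_neq1; exact: n1.
  by apply: n2; exists c.
have H6 (x : C) (g h : under x) : good _ g -> good _ h ->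
    exists j, is_join (@ldiv C x) g h j.
  move=> [s ->] [t ->]; have [_ _ /(_ s t)[j [sj tj jc] [Y xY]]] := nuP x.
  exists (@mk_over R Y x (exist _ j xY)).
  split; [exact/ribbon_rdivP|exact/ribbon_rdivP|].
  move=> c /ribbon_rdivP sc /ribbon_rdivP tc; apply/ribbon_rdivP.
  exact: (jc (mon_over _) sc tc).
have H7 (x : C) (g h : under x) : exists c, ldiv g c /\ ldiv h c.
  have [k [u gu]] := delta_rmultiple gG (sval (tagged g)).
  have [l [v hv]] := delta_rmultiple gG (sval (tagged h)).
  have [Y xY] := ribbon_deltaX_to (k + l) x.
  exists (@mk_over R Y x (exist _ _ xY)); split; apply/ribbon_rdivP => /=.
    by rewrite addnC expgnDr -gu mulgA; eexists.
  by rewrite expgnDr -hv mulgA; eexists.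
by split; [apply: (local_meet (proper_factor_wf gG) H1 H2 H3 H4 H5 H6 H7) |
           apply: (local_join (proper_factor_wf gG) H1 H2 H3 H4 H5 H6 H7)].
Qed.

End RibbonLattice.

(** * The semi-direct product *)

Section ReducedRibbons.
Variables (M : monoidType) (G : garside_data (monoid_cat M)).
Hypothesis gG : garside_structure G.
Variables (A : groupType) (iota : {multiplicative M -> A}).
Hypothesis hA : is_group_of_formal_inverses iota.
Hypothesis hnu : has_nu_structure G iota.
Local Notation R := (ribbon_category G iota).
Local Notation D := (gdelta G).

Definition reduced_ribbons : subcategory R :=
  @Subcategory R setT (fun X _ => [set v | reduced X (sval v)])
    (fun _ _ _ _ => conj I I) (fun X _ => @reduced1 _ _ gG X)
    (fun X Y Z v w => @reducedM _ _ gG _ _ hA X Y _ _ (svalP v)).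

Local Notation P := reduced_ribbons.

Lemma reduced_join (X : R) (a b j : under X) :
  reduced X (sval (tagged a)) -> reduced X (sval (tagged b)) ->
  is_join (@ldiv R X) a b j -> reduced X (sval (tagged j)).
Proof.
case: a b j => [Y [g XY]] [Y' [h XY']] [Z [j XZ]] /= rg rh [].
move=> /ribbon_ldivP/= gj /ribbon_ldivP/= hj jc.
have [a [b [Xa rb XZb jab]]] := ribbon_decomp gG hA XZ.
apply: (reduced_lle rb).
have /ribbon_ldivP/= : ldiv (@mk_under R X Z (exist _ j XZ))
    (@mk_under R X Z (exist _ b XZb)); last by [].
apply: jc.
  apply/ribbon_ldivP; exact: (reduced_lle_proj gG hA XY rg XZ Xa rb jab gj).
apply/ribbon_ldivP; exact: (reduced_lle_proj gG hA XY' rh XZ Xa rb jab hj).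
Qed.

Lemma reduced_join_to (X : R) (a b j : Defs.over X) :
  reduced (tag a) (sval (tagged a)) -> reduced (tag b) (sval (tagged b)) ->
  is_join (@rdiv R X) a b j -> reduced (tag j) (sval (tagged j)).
Proof.
case: a b j => [Y [g YX]] [Y' [h YX']] [Z [j ZX]] /= rg rh [].
move=> /ribbon_rdivP/= gj /ribbon_rdivP/= hj jc.
have [a [b [Za rb ZXb jab]]] := ribbon_decomp gG hA ZX.
have /ribbon_rdivP/= : rdiv (@mk_over R Z X (exist _ j ZX))
    (@mk_over R Z X (exist _ b ZXb)).
  apply: jc.
    apply/ribbon_rdivP; exact: (reduced_rle_proj gG hA YX rg ZX Za rb jab gj).
  apply/ribbon_rdivP; exact: (reduced_rle_proj gG hA YX' rh ZX Za rb jab hj).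
move=> [u bu]; have [_ a1] : u = 1 /\ a = 1.
  apply: (mul_eq1 gG); apply: (rcancel gG (a := b)).
  by rewrite mul1g -mulgA -jab -bu.
by rewrite jab a1 mul1g.
Qed.

Lemma reduced_gphi (X : parab G) g :
  reduced (Phi_parab gG X) (gphi G g) <-> reduced X g.
Proof.
have inj := gphi_inj gG.
split=> [r x Xx xg|r _ [x Xx <-] xg].
  by apply: inj; rewrite gphi1; apply: r; [exists x | exact/gphi_lle].
by rewrite -[RHS](gphi1 G); congr gphi; apply: r => //; exact/(gphi_lle gG).
Qed.

Lemma ribbon_gphi (X Y : parab G) g :
  ribbon iota (Phi_parab gG X) (Phi_parab gG Y) (gphi G g) <-> ribbon iota X Y g.
Proof.
split=> [XY|]; last exact: (Phi_ribbon gG).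
apply: (ribbon_rcancel (Delta_ribbon gG iota Y)).
rewrite -(gdeltaC gG); exact: ribbonM (Delta_ribbon gG iota X) XY.
Qed.

Lemma delta_reduced_part (X : parab G) : exists b,
  [/\ ribbon iota X (Phi_parab gG X) b, reduced X b
    & exists2 a, sval X a & D = a * b].
Proof.
have [a [b [Xa rb XY ab]]] := ribbon_decomp gG hA (Delta_ribbon gG iota X).
by exists b; split=> //; exists a.
Qed.

Lemma reduced_ribbons_parabolic : parabolic (ribbon_garside gG iota) P.
Proof.
split.
  move=> X _; split=> a b ra rb.
    have [[m Hm] [j Hj]] := ribbon_ljoin gG hA hnu a b.
    split; last by exists j => //; exact: reduced_join ra rb Hj.
    exists m => //; have [/ribbon_ldivP ma _ _] := Hm; exact: reduced_lle ra ma.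
  have [[m Hm] [j Hj]] := ribbon_rjoin gG hA hnu a b.
  split; last by exists j => //; exact: reduced_join_to ra rb Hj.
  exists m => //; have [[u au] _ _] := Hm.
  have := ra; rewrite /sub_over /= au /=.
  exact: (reduced_rfactor gG hA (svalP u)).
pose C := cat_of_sub P.
pose phio (X : C) : C := exist _ (Phi_parab gG (sval X)) I.
pose phim (X Y : C) (v : @hom C X Y) : @hom C (phio X) (phio Y) :=
  exist _ (fmap (Phi_ribbon_functor gG iota) (sval v))
    ((reduced_gphi _ _).2 (svalP v)).
have phi1 (X : C) : phim X X (idm X) = idm (phio X).
  by apply: sval_inj; exact: (fmap_id (Phi_ribbon_functor gG iota)).
have phiM (X Y Z : C) (v : @hom C X Y) (w : @hom C Y Z) :
    phim _ _ (Defs.comp v w) = Defs.comp (phim _ _ v) (phim _ _ w).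
  by apply: sval_inj; exact: (fmap_comp (Phi_ribbon_functor gG iota)).
pose b (X : C) : M := projT1 (cid (delta_reduced_part (sval X))).
have bP (X : C) : [/\ ribbon iota (sval X) (sval (phio X)) (b X),
    reduced (sval X) (b X) & exists2 a, sval (sval X) a & D = a * b X].
  exact: projT2 (cid (delta_reduced_part (sval X))).
have bR (X : C) : ribbon iota (sval X) (sval (phio X)) (b X) by have [] := bP X.
exists (@Functor C C phio phim phi1 phiM),
  (fun X : C => exist _ (b X) (bR X) : @hom R (sval X) (sval (phio X))); split.
- split.
    exists (fun X : C => exist _ (Phi_parab_inv gG (sval X)) I : C) => X;
      by apply: sval_inj; rewrite /= ?Phi_parabK ?Phi_parab_invK.
  move=> X Y; have [E FK EK] := gphi_bij gG.
  have /choice[psi psiP] : forall w : @hom C (phio X) (phio Y),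
      exists v : @hom C X Y, phim _ _ v = w.
    move=> [[w Hw] rw].
    have XY : ribbon iota (sval X) (sval Y) (E w) by apply/ribbon_gphi; rewrite EK.
    have rE : reduced (sval X) (E w) by apply/reduced_gphi; rewrite EK.
    exists (exist _ (exist _ (E w) XY : @hom R (sval X) (sval Y)) rE).
    by apply: sval_inj; apply: sval_inj; exact: EK.
  have phim_inj : injective (phim X Y).
    move=> v w /(congr1 (fun u => sval (sval u))) /(gphi_inj gG) vw.
    by apply: sval_inj; exact: sval_inj.
  by exists psi => v; [apply: phim_inj; rewrite psiP | exact: psiP].
- move=> X Y v; apply: sval_inj; rewrite /=.
  have [_ rX [aX XaX DX]] := bP X; have [_ rY [aY YaY DY]] := bP Y.
  case: v => -[v XY] rv /=.
  have [_ /(_ aY YaY)[x Xx xv]] := (ribbonP gG hA _ _ _).1 XY.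
  have [] := @reduced_decomp_uniq _ _ gG (sval X) aX x
    (b X * gphi G v) (v * b Y) XaX Xx.
  + apply: (reducedM gG hA (bR X) rX); exact/reduced_gphi.
  + exact: (reducedM gG hA XY rv rY).
  + by rewrite mulgA -DX (gdeltaC gG) {1}DY !mulgA xv.
  by [].
- move=> X; set Dl := mk_under _ => /=.
  have [_ rX [a Xa DX]] := bP X.
  have bD : lle (b X) D.
    have [/(_ a Xa)[y _ ay] _] := (ribbonP gG hA _ _ _).1 (bR X).
    by rewrite DX ay; exact: lle_mulr.
  have divP (v : @under R (sval X)) :
      ldiv v (@mk_under R _ (sval (phio X)) (exist _ (b X) (bR X))) <->
      ldiv v Dl /\ reduced (sval X) (sval (tagged v)).
    split=> [/ribbon_ldivP vb|[/ribbon_ldivP vD rv]].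
      split; last exact: reduced_lle rX vb.
      by apply/ribbon_ldivP; exact: lle_trans vb bD.
    apply/ribbon_ldivP; apply: (reduced_lle_proj gG hA (svalP (tagged v)) rv
      (Delta_ribbon gG iota (sval X)) Xa rX DX vD).
  split; apply/predeqP => v; split.
  + by move/divP.
  + by move=> H; apply/divP.
  + move=> /divP[vD rv]; exists v => //; split=> //.
    by exists (idm _); rewrite compm1.
  + move=> [p rp [mD /ribbon_ldivP mp _]]; apply/divP; split=> //.
    exact: reduced_lle rp mp.
Qed.

Local Notation RA := (ribbon_groupoid G iota).
Local Notation J := (ribbon_functor G iota).

Definition nu_subgroupoid : subgroupoid RA := generated_subgroupoid J P.

Lemma gen_fraction (X Y : RA) (g : hom X Y) : gen_hom J P g ->
  exists (Z : parab G) p q, [/\ ribbon iota X Z p /\ reduced X p,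
    ribbon iota Y Z q /\ reduced Y q & sval g = iota p * (iota q)^-1].
Proof.
elim=> {X Y g} [X Y [v XY] rv|X Y Z g h _ [U [p [q [[XU rp] [YU rq] gE]]]]
    _ [V [r [s [[YV rr] [ZV rs] hE]]]]|X Y g _ [Z [p [q [Hp Hq gE]]]]].
- exists Y, v, 1; split=> //; last by rewrite /= iota1 invg1 mulg1.
  by split; [exact: ribbon1 | exact: reduced1].
- have [_ [[W [j YW]] Hj]] := ribbon_ljoin gG hA hnu
    (@mk_under R Y U (exist _ q YU)) (@mk_under R Y V (exist _ r YV)).
  have rj : reduced Y j by exact: (reduced_join _ _ Hj).
  have [/ribbon_ldivP/= [u ju] /ribbon_ldivP/= [v jv] _] := Hj.
  have UW : ribbon iota U W u by apply: (ribbon_lcancel YU); rewrite -ju.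
  have VW : ribbon iota V W v by apply: (ribbon_lcancel YV); rewrite -jv.
  have ru : reduced U u by apply: (reduced_rfactor gG hA YU); rewrite -ju.
  have rv : reduced V v by apply: (reduced_rfactor gG hA YV); rewrite -jv.
  exists W, (p * u), (s * v); split.
  + by split; [exact: ribbonM XU UW | exact: (reducedM gG hA XU)].
  + by split; [exact: ribbonM ZV VW | exact: (reducedM gG hA ZV)].
  rewrite /= gE hE; apply: (mulIg (iota (s * v))); rewrite mulgVK !gmulfM !mulgA mulgVK.
  by rewrite -[LHS]mulgA -[X in _ * X = _]gmulfM -jv ju gmulfM -!mulgA mulKg.
- by exists Z, q, p; split=> //; rewrite /= gE invgM invgK.
Qed.

Lemma std_reduced_fraction (X : parab G) p q : reduced X p -> reduced X q ->
  std iota X (iota p * (iota q)^-1) -> p = q.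
Proof.
move=> rp rq /(std_lfrac gG)[x1 [x2 [X1 X2 e]]].
have [] := @reduced_decomp_uniq _ _ gG X x2 x1 p q X2 X1 rp rq _; last by [].
apply: (iota_inj gG hA); rewrite !gmulfM; apply: (mulIg (iota q)^-1).
by rewrite mulgK -mulgA e mulVKg.
Qed.

Lemma nu_semidirect :
  semidirect_product (parabolic_groupoid G iota) (ribbon_in_conj nu_subgroupoid).
Proof.
split.
- by move=> X Y v [].
- move=> X Z [g XZ].
  have [m [k gE]] := iota_frac gG hA g.
  have [Z' ZZ'] := @ribbon_deltaX _ _ gG _ iota k Z.
  have XZ' : is_std_conj iota X Z' (iota m).
    have -> : iota m = g * iota (D ^+ k) by rewrite gE mulgVK.
    exact: is_std_conjM XZ (ribbon_std_conj ZZ').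
  have [a [b [Xa rb XZb mE]]] := std_conj_decomp gG hA XZ'.
  have [e [r [Ze rr ZZr DE]]] := ribbon_decomp gG hA ZZ'.
  pose v : @hom RA X Z := (fmap J (exist _ b XZb : @hom R X Z') >>
    invm (fmap J (exist _ r ZZr : @hom R Z Z')))%cat.
  have Qv : sub_hom nu_subgroupoid v.
    apply: gen_comp; first exact: (@gen_fmap R RA J P X Z').
    by apply: gen_inv; exact: (@gen_fmap R RA J P Z Z').
  have XZv : is_std_conj iota X Z (sval v) := ribbon_std_conj (svalP v).
  pose x := (iota e)^-1 ^ (sval v)^-1.
  have Xx : std iota X x.
    have [_ H] := (std_conjP _ _ _ _).1 XZv.
    by apply: H; apply: stdV; exact: iota_std.
  have Xax : std iota X (iota a * x) by apply: stdM => //; exact: iota_std.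
  pose g1 : @hom (conj_groupoid G iota) X X := exist _ _ (std_conj_id Xax).
  pose g2 : @hom (conj_groupoid G iota) X Z := exist _ _ XZv.
  have g12 : g = iota a * x * sval v.
    rewrite /= /x conjgE invgK -!mulgA mulVg mulg1.
    by rewrite gE mE DE !gmulfM invgM !mulgA.
  exists (existT _ (X : conj_groupoid G iota) (g1, g2)); split.
    by split=> //=; [exists v | exact: sval_inj].
  move=> [Y [h1 h2]] /= [[XY]]; case: Y / XY h1 h2 => h1 h2 Xh1 [w Qw wE].
  move=> /(congr1 sval)/= gh.
  have c1 : (sval h1)^-1 * (iota a * x) = 1.
    have e1 : (sval h1)^-1 * (iota a * x) = sval (w >> invm v : @hom RA X X)%cat.
      by apply: (mulIg (sval v)); rewrite /= mulgVK wE -mulgA -g12 gh mulKg.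
    have Q1 : gen_hom J P (w >> invm v : @hom RA X X)%cat.
      by apply: gen_comp => //; exact: gen_inv.
    have [U [p [q [[_ rp] [_ rq] pq]]]] := gen_fraction Q1.
    rewrite e1 pq (std_reduced_fraction rp rq) ?mulgV //.
    by rewrite -pq -e1; apply: stdM => //; exact: stdV.
  have h1E : h1 = g1.
    by apply: sval_inj => /=; rewrite -[LHS]mulg1 -c1 mulVKg.
  have h2E : h2 = g2.
    apply: sval_inj => /=; apply: (mulgI (sval h1)).
    by rewrite -gh g12 h1E.
  by rewrite h1E h2E.
- move=> X Y g [r Qr rg]; have [XY YX] := (std_conjP _ _ _ _).1 (svalP g).
  apply/predeqP => h; split=> [[d [_ Xd] <-]|[d [_ Yd] <-]].
    have Yd := XY _ Xd.
    exists (exist _ _ (std_conj_id Yd)) => //.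
    by apply: sval_inj; rewrite /= conjgE mulVKg.
  have Xd := YX _ Yd.
  exists (exist _ _ (std_conj_id Xd)) => //.
  by apply: sval_inj; rewrite /= conjgE invgK -!mulgA mulVg mulg1.
Qed.

End ReducedRibbons.

Theorem theorem1p3
  (M : monoidType) (G : garside_data (monoid_cat M))
  (gG : garside_structure G)
  (A : groupType) (iota : {multiplicative M -> A})
  (hA : is_group_of_formal_inverses iota)
  (hnu : has_nu_structure G iota) :
  exists Rnu : subgroupoid (ribbon_groupoid G iota),
    standard_parabolic_subgroupoid
      (ribbon_garside gG iota) (ribbon_functor G iota) Rnu /\
    semidirect_product (parabolic_groupoid G iota) (ribbon_in_conj Rnu).
Proof.
exists (nu_subgroupoid gG hA); split; last exact: nu_semidirect.
exists (reduced_ribbons gG hA); split=> //; exact: reduced_ribbons_parabolic.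
Qed.
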